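(* Let $k,\ell$ be fixed integers with $k/2<\ell<k$, and let $n\to\infty$ range over multiples of $\ell$. Let $p=p(n)\in(0,1]$ and $\epsilon=\epsilon(n)$ satisfy $\epsilon<1$ and $\epsilon^5 n^{1/2}p^2/\log^3 n\to\infty$. Let $H=([n],\mathcal E)$ be a $k$-uniform hypergraph with $m$ edges, where $p=m/\binom{n}{k}$, satisfying: (P_a) $d_H(S)\ge\lceil(1-\epsilon)\binom{n-2(k-\ell)}{2\ell-k}p\rceil$ for all $S\in\binom{[n]}{2(k-\ell)}$; (P_b) $d_H(S)\ge\lceil(1-\epsilon)\binom{n-2\ell+k}{2(k-\ell)}p\rceil$ for all $S\in\binom{[n]}{2\ell-k}$; (P_c) $d_H(S)\le\lfloor(1+\epsilon)\binom{n-2k+2\ell-1}{2\ell-k-1}p\rfloor$ for all $S\in\binom{[n]}{2(k-\ell)+1}$; (P_d) $d_H(S)\le\lfloor(1+\epsilon)\binom{n-2\ell+k-1}{2(k-\ell)-1}p\rfloor$ for all $S\in\binom{[n]}{2\ell-k+1}$; (P_e) $|N_H(S_1)\cap N_H(S_2)|\le\lfloor(1+\epsilon)\binom{n-2(2\ell-k)}{2(k-\ell)}p^2\rfloor$ for all disjoint $S_1,S_2\in\binom{[n]}{2\ell-k}$; (P_f) $|N_H(S_1)\cap N_H(S_2)|\le\lfloor(1+\epsilon)\binom{n}{2\ell-k}p^2\rfloor$ for all $S_1,S_2\in\binom{[n]}{2(k-\ell)}$ with $|S_1\cap S_2|\in\{0,k-\ell\}$. Then, for $n$ sufficiently large, $H$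 contains a collection of at least $(1-2\epsilon^{1/3})m/\nu_\ell$ pairwise edge-disjoint type $\ell$ Hamilton cycles, where $\nu_\ell=n/\ell$.
   Context: For a $k$-uniform hypergraph $H=([n],\mathcal E)$ and $X\subseteq[n]$ with $|X|=a<k$, the neighbourhood is $N_H(X)=\{Y\in\binom{[n]}{k-a}: X\cup Y\in\mathcal E\}$ and the degree is $d_H(X)=|N_H(X)|$. For $1\le \ell\le k$ and $\ell\mid n$, a type $\ell$ Hamilton cycle in a $k$-uniform hypergraph on $n$ vertices is a collection of $\nu_\ell=n/\ell$ edges $E_1,\dots,E_{\nu_\ell}$ such that for some cyclic ordering of the vertex set every edge consists of $k$ consecutive vertices and for every pair of consecutive edges $E_{i-1},E_i$ (indices mod $\nu_\ell$) we have $|E_{i-1}\setminus E_i|=\ell$. *)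

(* Defs.v *)
From Stdlib Require Import Reals.
From mathcomp Require Import all_boot perm.
Delimit Scope R_scope with Re.
Set Implicit Arguments. Unset Strict Implicit. Unset Printing Implicit Defensive.

(* floor and ceiling on Stdlib reals: Int_part x = up x - 1 is the floor *)
Definition Rfloor (x : R) : R := IZR (Int_part x).
Definition Rceil (x : R) : R := (- Rfloor (- x))%Re.

Definition k_uniform (n k : nat) (H : {set {set 'I_n}}) : Prop :=
  forall e, e \in H -> #|e| = k.

Definition nbhd (n k : nat) (H : {set {set 'I_n}}) (X : {set 'I_n}) : {set {set 'I_n}} :=
  [set Y : {set 'I_n} | (#|Y| == k - #|X|) && (X :|: Y \in H)].

Definition deg (n k : nat) (H : {set {set 'I_n}}) (X : {set 'I_n}) : nat :=
  #|nbhd k H X|.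

(* the set of k consecutive vertices starting at position s in the cyclic
   ordering in which vertex v sits at position sigma v *)
Definition consec (n k : nat) (sigma : {perm 'I_n}) (s : nat) : {set 'I_n} :=
  [set v : 'I_n | (sigma v + n - s) %% n < k].

Definition ham_cycle (n k l : nat) (H : {set {set 'I_n}}) (C : {set {set 'I_n}}) : Prop :=
  l %| n /\
  exists (sigma : {perm 'I_n}) (E : nat -> {set 'I_n}),
    C = [set E (nat_of_ord i) | i : 'I_(n %/ l)] /\ #|C| = n %/ l /\
    (forall i, i < n %/ l ->
       E i \in H /\ exists s, s < n /\ E i = consec k sigma s) /\
    (forall i, i < n %/ l ->
       #|E ((i + n %/ l).-1 %% (n %/ l)) :\: E i| = l).

Definition Pa (n k l : nat) (H : {set {set 'I_n}}) (p eps : R) : Prop :=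
  forall S : {set 'I_n}, #|S| = 2 * (k - l) ->
    (Rceil ((1 - eps) * INR 'C(n - 2 * (k - l), 2 * l - k) * p) <= INR (deg k H S))%Re.

Definition Pb (n k l : nat) (H : {set {set 'I_n}}) (p eps : R) : Prop :=
  forall S : {set 'I_n}, #|S| = 2 * l - k ->
    (Rceil ((1 - eps) * INR 'C(n - 2 * l + k, 2 * (k - l)) * p) <= INR (deg k H S))%Re.

Definition Pc (n k l : nat) (H : {set {set 'I_n}}) (p eps : R) : Prop :=
  forall S : {set 'I_n}, #|S| = 2 * (k - l) + 1 ->
    (INR (deg k H S) <= Rfloor ((1 + eps) * INR 'C(n - 2 * k + 2 * l - 1, 2 * l - k - 1) * p))%Re.

Definition Pd (n k l : nat) (H : {set {set 'I_n}}) (p eps : R) : Prop :=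
  forall S : {set 'I_n}, #|S| = 2 * l - k + 1 ->
    (INR (deg k H S) <= Rfloor ((1 + eps) * INR 'C(n - 2 * l + k - 1, 2 * (k - l) - 1) * p))%Re.

Definition Pe (n k l : nat) (H : {set {set 'I_n}}) (p eps : R) : Prop :=
  forall S1 S2 : {set 'I_n}, #|S1| = 2 * l - k -> #|S2| = 2 * l - k ->
    [disjoint S1 & S2] ->
    (INR #|nbhd k H S1 :&: nbhd k H S2|
       <= Rfloor ((1 + eps) * INR 'C(n - 2 * (2 * l - k), 2 * (k - l)) * p ^ 2))%Re.

Definition Pf (n k l : nat) (H : {set {set 'I_n}}) (p eps : R) : Prop :=
  forall S1 S2 : {set 'I_n}, #|S1| = 2 * (k - l) -> #|S2| = 2 * (k - l) ->
    (#|S1 :&: S2| = 0 \/ #|S1 :&: S2| = k - l) ->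
    (INR #|nbhd k H S1 :&: nbhd k H S2|
       <= Rfloor ((1 + eps) * INR 'C(n, 2 * l - k) * p ^ 2))%Re.

Definition growth_cond (l : nat) (p eps : nat -> R) : Prop :=
  forall M : R, exists N : nat, forall n : nat, N <= n -> l %| n ->
    (M < eps n ^ 5 * sqrt (INR n) * p n ^ 2 / ln (INR n) ^ 3)%Re.

(* Main.v *)
(** Put [a = k - l] and [b = 2 l - k], so that [l = a + b] and [k = 2 a + b].
    A permutation of the vertices cuts the cyclic order into consecutive blocks
    [A_0 B_0 A_1 B_1 ...] with [#|A_i| = a] and [#|B_j| = b], and defines a bipartite
    graph on the pairs [(j, i)] for which [A_i :|: A_(i+1) :|: B_j] is an edge of [H];
    a perfect matching, putting [B_j] between [A_i] and [A_(i+1)], is a type [l]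
    Hamilton cycle.  A transposition changes few of the blocks, so by the martingale
    inequality on the symmetric group all but few permutations give a bipartite graph
    with the expected minimum degrees and codegrees.  About
    [K * 'C(n, k) / nu ^ 2] such permutations can be chosen covering no edge more
    than [K] times, with [K] of order [ln n / eps ^ (2/3)]; colouring [H] randomly with
    [K] colours assigns each edge to at most one of the bipartite graphs containing it
    and keeps them pseudorandom at density [p / K].  Finally a pseudorandom bipartite
    graph of minimum degree close to [d] satisfies [e(X, Y) >= D (#|X| + #|Y| - nu)]
    with [D] close to [d], and therefore has a [D]-factor, that is, [D] disjoint perfect
    matchings. *)
Require Import Defs.
From Stdlib Require Import Reals.
From mathcomp Require Import all_boot perm.
From mathcomp Require Import all_order all_algebra.
From mathcomp Require Import Rstruct.
From mathcomp Require Import ring lra zify.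
Import Order.TTheory GRing.Theory Num.Theory.

Set Implicit Arguments. Unset Strict Implicit. Unset Printing Implicit Defensive.

(** * Factors and perfect matchings of bipartite graphs *)

Section Factor.
Variables A B : finType.
Implicit Types (F G : {set A * B}) (a : A) (b : B).

(** Two opposing demands fix [K]; write [w = eps ^ (1/3)]. Keeping every edge within [K] covers at a
    relative loss of order [w] is a Chernoff estimate over all edges, so [K * w ^ 2] has to dominate
    [k * ln n]. But splitting lowers the degree scale to [d = p * nu / K] and the codegree scale to
    [d ^ 2 / nu], and the expansion estimate asks for [nu] of order at most [eps ^ 2 * w * d ^ 2].
    The growth condition reconciles the two. Its factor [n ^ (1/2) * p ^ 2] comes from the
    martingale: codegrees have mean about [p ^ 2 * nu], the allowed deviation is of order
    [eps * p ^ 2 * nu] and the Lipschitz constant is absolute, so the exponent [eps ^ 2 * p ^ 4 * n]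
    must exceed a multiple of [ln n]. Expansion with degree error [eta] of order [eps] loses a
    proportion [beta] with [3 * eta <= beta ^ 2]. Taking [beta] of order [w] makes this loss
    comparable to that of the cover; together with the rounding they stay below [2 * w]. *)

Definition rdeg F a := \sum_b ((a, b) \in F : nat).
Definition cdeg F b := \sum_a ((a, b) \in F : nat).

Lemma rdegU F x a : x \notin F -> rdeg (x |: F) a = (x.1 == a) + rdeg F a.
Proof.
case: x => u v xF; rewrite /rdeg (bigD1 v) //= [in RHS](bigD1 v) //= !inE addnA.
congr (_ + _); last first.
  by apply: eq_bigr => b /negPf bv; rewrite !inE xpair_eqE bv andbF.
rewrite xpair_eqE eqxx andbT eq_sym; have [<-|_] //= := eqVneq u a.
by rewrite (negPf xF).
Qed.

Lemma cdegU F x b : x \notin F -> cdeg (x |: F) b = (x.2 == b) + cdeg F b.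
Proof.
case: x => u v xF; rewrite /cdeg (bigD1 u) //= [in RHS](bigD1 u) //= !inE addnA.
congr (_ + _); last first.
  by apply: eq_bigr => a /negPf av; rewrite !inE xpair_eqE av.
rewrite xpair_eqE eqxx /= eq_sym; have [<-|_] //= := eqVneq v b.
by rewrite (negPf xF).
Qed.

Lemma rdegD F x a : x \in F -> rdeg F a = (x.1 == a) + rdeg (F :\ x) a.
Proof. by move=> xF; rewrite -{1}(setD1K xF) rdegU // !inE eqxx. Qed.

Lemma cdegD F x b : x \in F -> cdeg F b = (x.2 == b) + cdeg (F :\ x) b.
Proof. by move=> xF; rewrite -{1}(setD1K xF) cdegU // !inE eqxx. Qed.

Lemma card_setIX F (X : {set A}) (Y : {set B}) :
  #|F :&: setX X Y| = \sum_(a in X) \sum_(b in Y) ((a, b) \in F).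
Proof.
rewrite pair_big /= -sum1_card big_mkcond [RHS]big_mkcond /=.
apply: eq_bigr => -[a b] _ /=; rewrite !inE /=.
by case: (_ \in F); case: (a \in X); case: (b \in Y).
Qed.

Definition subfactor G D F :=
  [&& F \subset G, [forall a, rdeg F a <= D] & [forall b, cdeg F b <= D]].

Definition alternating G F a a' :=
  [exists b, ((a, b) \in G :\: F) && ((a', b) \in F)].

Lemma sub_path_mem (T : eqType) (e e' : rel T) x s :
  (forall y z, y \in x :: s -> z \in s -> e y z -> e' y z) ->
  path e x s -> path e' x s.
Proof.
elim: s x => //= y s IH x ee' /andP[exy pys].
rewrite ee' ?mem_head //=; apply: IH => // u v us vs.
by apply: ee'; rewrite in_cons ?us ?vs orbT.
Qed.

(* Exchanging edges of [F] along an alternating walk moves the deficiency from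
   its origin to its end without touching the column degrees. *)
Lemma shift_deficiency G D p F a :
  subfactor G D F -> rdeg F a < D -> path (alternating G F) a p -> uniq (a :: p) ->
  exists F', [/\ subfactor G D F', #|F'| = #|F|, cdeg F' =1 cdeg F,
     rdeg F' (last a p) < D & forall b, (last a p, b) \in F' -> (last a p, b) \in F].
Proof.
elim: p F a => [|a1 p IH] F a sF da; first by exists F; split.
move=> /= /andP[/existsP[b /andP[/setDP[abG abF] a1bF]] pa1].
rewrite in_cons negb_or => /andP[/andP[aa1 ap] ua1].
pose F1 := (a, b) |: (F :\ (a1, b)).
have abF' : (a, b) \notin F :\ (a1, b) by rewrite !inE (negPf abF) andbF.
have cF1 : cdeg F1 =1 cdeg F.
  by move=> b'; rewrite cdegU // [RHS](cdegD _ a1bF).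
have rF1 a' : rdeg F1 a' + (a1 == a') = (a == a') + rdeg F a'.
  by rewrite rdegU // [in RHS](rdegD _ a1bF) /= -addnA (addnC (rdeg _ _)).
have sF1 : subfactor G D F1.
  move: sF => /and3P[FG /forallP rF /forallP cF]; apply/and3P; split.
  - rewrite subUset sub1set abG (subset_trans _ FG) ?subD1set //.
  - apply/forallP=> a'; have := rF1 a'; have := rF a'; move: da.
    by have [<-|_] := eqVneq a a'; clear; lia.
  - by apply/forallP=> b'; rewrite cF1.
have d1 : rdeg F1 a1 < D.
  have := rF1 a1; rewrite eqxx (negPf aa1) /= add0n.
  by move: sF => /and3P[_ /forallP/(_ a1) + _]; clear; lia.
have c1 : #|F1| = #|F| by rewrite cardsU1 abF' (cardsD1 (a1, b) F) a1bF.
have p1 : path (alternating G F1) a1 p.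
  apply: sub_path_mem pa1 => y z ys zp /existsP[b' /andP[/setDP[yG yF] zF]].
  have ya : y != a.
    by apply: contraTneq ys => ->; rewrite in_cons (negPf aa1).
  have za1 : z != a1 by apply: contraTneq zp => ->; case/andP: ua1.
  apply/existsP; exists b'.
  by rewrite !inE !xpair_eqE (negPf ya) (negPf za1) (negPf yF) yG zF /= ?andbF ?orbT.
have [F' [sF' cardF' cF' dF' lF']] := IH F1 a1 sF1 d1 p1 ua1.
exists F'; split=> //; first by rewrite cardF' c1.
- by move=> b'; rewrite cF' cF1.
- move=> b' /lF'; rewrite !inE xpair_eqE.
  have -> : (last a1 p == a) = false.
    apply/negbTE; apply: contraTneq (mem_last a1 p) => ->.
    by rewrite in_cons negb_or aa1.
  by case/andP.
Qed.

(** A max-flow min-cut argument. In a largest [F] with all degrees at most [D], let [X] be the rows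
    reachable from a deficient row by alternating walks and [W] the columns met on the way. By
    maximality the columns of [W] are saturated; their [F]-edges all come from [X], and every
    [G]-edge from [X] to the complement of [W] is in [F]. So the degrees over [X] sum to
    [#|G :&: setX X (~: W)| + D * #|W|], yet to less than [D * #|X|], against the hypothesis for [X]
    and [~: W]. *)
Lemma bipartite_factor G D :
  #|A| = #|B| ->
  (forall (X : {set A}) (Y : {set B}),
     D * (#|X| + #|Y|) <= #|G :&: setX X Y| + D * #|A|) ->
  exists F, [/\ F \subset G, forall a, rdeg F a = D & forall b, cdeg F b = D].
Proof.
move=> cAB hG.
have s0 : subfactor G D set0.
  apply/and3P; split; first exact: sub0set.
    by apply/forallP=> a; rewrite /rdeg big1 // => b _; rewrite inE.
  by apply/forallP=> b; rewrite /cdeg big1 // => a _; rewrite inE.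
have [F sF maxF] : exists2 F, subfactor G D F &
    forall F', subfactor G D F' -> #|F'| <= #|F|.
  by have [F sF maxF] := arg_maxnP (fun F : {set A * B} => #|F|) s0; exists F.
have /and3P[FG /forallP rF /forallP cF] := sF.
suff rD : forall a, rdeg F a = D.
  exists F; split=> // b; apply/eqP; rewrite eqn_leq cF leqNgt; apply/negP => cb.
  have : \sum_b cdeg F b < \sum_(b : B) D.
    rewrite (bigD1 b) //= [X in _ < X](bigD1 b) //= -addSn leq_add //.
    by apply: leq_sum => b' _; exact: cF.
  rewrite /cdeg exchange_big /= (eq_bigr (fun=> D)); last by move=> a _; exact: rD.
  by rewrite !sum_nat_const -cAB ltnn.
move=> a0; apply/eqP; rewrite eqn_leq rF leqNgt; apply/negP => da0.
pose X := [set a | connect (alternating G F) a0 a].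
pose W := [set b | [exists a in X, (a, b) \in G :\: F]].
have WD b : b \in W -> cdeg F b = D.
  rewrite inE => /existsP[a /andP[]]; rewrite inE => /connectP[p pp al] abGF.
  apply/eqP; rewrite eqn_leq cF leqNgt; apply/negP => db.
  have [q qq uq] : exists2 q, path (alternating G F) a0 q &
     uniq (a0 :: q) /\ a = last a0 q.
    by case/shortenP: pp al => q qq uq _ ->; exists q.
  have [F' [sF' cardF' cF' dF' lF']] := shift_deficiency sF da0 qq (proj1 uq).
  move: abGF uq dF' lF' => /setDP[abG abF] [_ <-] dF' lF'.
  (* The shift creates no new edge at its endpoint, so [(a, b)] is still available and adding it
     really enlarges [F']. *)
  have abF' : (a, b) \notin F' by apply: contra abF; exact: lF'.
  suff : subfactor G D ((a, b) |: F').
    by move=> /maxF; rewrite cardsU1 abF' cardF' add1n ltnn.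
  have /and3P[F'G /forallP rF' /forallP cF''] := sF'.
  apply/and3P; split; first by rewrite subUset sub1set abG.
    apply/forallP => a'; rewrite rdegU //=.
    by have [<-|_] := eqVneq a a'; [exact: dF' | exact: rF'].
  apply/forallP => b'; rewrite cdegU //= cF'.
  by have [<-|_] := eqVneq b b'; [exact: db | exact: cF].
have hF : #|G :&: setX X (~: W)| = #|F :&: setX X (~: W)|.
  rewrite !card_setIX; apply: eq_bigr => a aX.
  apply: eq_bigr => b; rewrite inE => bW.
  case abF: (_ \in F); first by rewrite (subsetP FG _ abF).
  case abG: (_ \in G) => //; case/negP: bW; rewrite inE.
  by apply/existsP; exists a; rewrite aX inE abF abG.
have hW : \sum_(a in X) \sum_(b in W) ((a, b) \in F) = D * #|W|.
  rewrite exchange_big /= mulnC -sum_nat_const; apply: eq_bigr => b bW.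
  rewrite -(WD _ bW) /cdeg [LHS]big_mkcond; apply: eq_bigr => a _.
  case: ifP => // /negbT aX; case abF: (_ \in F) => //; case/negP: aX.
  move: bW; rewrite inE => /existsP[a' /andP[a'X a'b]].
  move: a'X; rewrite !inE => /connect_trans; apply; apply: connect1.
  by apply/existsP; exists b; rewrite a'b abF.
have : \sum_(a in X) rdeg F a < D * #|X|.
  have a0X : a0 \in X by rewrite inE connect0.
  rewrite mulnC -sum_nat_const (bigD1 a0) //= [X in _ < X](bigD1 a0) //= -addSn.
  by apply: leq_add => //; apply: leq_sum => a _; exact: rF.
have -> : \sum_(a in X) rdeg F a = #|F :&: setX X (~: W)| + D * #|W|.
  rewrite card_setIX -hW -big_split /=; apply: eq_bigr => a _.
  rewrite /rdeg (bigID (mem W)) /= addnC; congr (_ + _).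
  by apply: eq_bigl => b; rewrite in_setC.
have := hG X (~: W); rewrite hF cAB -(cardsC W) !mulnDr.
by clear; lia.
Qed.

End Factor.

(** * Decomposition of regular bipartite graphs into perfect matchings *)

Section Matchings.
Variable I : finType.
Implicit Types (F G : {set I * I}).

Lemma rdegB F F1 a : F1 \subset F -> rdeg F a = rdeg F1 a + rdeg (F :\: F1) a.
Proof.
move=> /subsetP sF; rewrite /rdeg -big_split; apply: eq_bigr => b _.
by rewrite inE; have := sF (a, b); case: (_ \in F1) => [/(_ isT) ->|_].
Qed.

Lemma cdegB F F1 b : F1 \subset F -> cdeg F b = cdeg F1 b + cdeg (F :\: F1) b.
Proof.
move=> /subsetP sF; rewrite /cdeg -big_split; apply: eq_bigr => a _.
by rewrite inE; have := sF (a, b); case: (_ \in F1) => [/(_ isT) ->|_].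
Qed.

Lemma regular1_perm F :
  (forall a, rdeg F a = 1) -> (forall b, cdeg F b = 1) ->
  exists m : {perm I}, forall a, (a, m a) \in F.
Proof.
move=> rF cF; pose f a := odflt a [pick b | (a, b) \in F].
have fF a : (a, f a) \in F.
  rewrite /f; case: pickP => //= h; have := rF a.
  by rewrite /rdeg big1 // => b _; rewrite h.
have fi : injective f.
  move=> a a' ff; apply/eqP; apply: contraT => aa'.
  have := cF (f a); rewrite /cdeg (bigD1 a) //= fF (bigD1 a') /=; last by rewrite eq_sym.
  by rewrite ff fF.
by exists (perm fi) => a; rewrite permE.
Qed.

(** A 1-factor is removed and the rest is again regular. The cut condition for the 1-factor holds
    because at most [D.+1 * #|~: Y|] of the [D.+1 * #|X|] edges at [X] can avoid [Y]. *)
Lemma regular_matchings D F :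
  (forall a, rdeg F a = D) -> (forall b, cdeg F b = D) ->
  exists ms : seq {perm I}, [/\ size ms = D,
    forall m, m \in ms -> forall a, (a, m a) \in F &
    pairwise (fun m m' : {perm I} => [forall a, m a != m' a]) ms].
Proof.
elim: D F => [|D IH] F rF cF; first by exists [::].
have [//|X Y|F1 [F1F rF1 cF1]] := @bipartite_factor I I F 1.
  have e : #|F :&: setX X Y| + #|F :&: setX X (~: Y)| = D.+1 * #|X|.
    rewrite !card_setIX -big_split mulnC -sum_nat_const /=.
    apply: eq_bigr => a _; rewrite -(rF a) /rdeg [RHS](bigID (mem Y)) /=.
    by congr (_ + _); apply: eq_bigl => b; rewrite inE.
  have le : #|F :&: setX X (~: Y)| <= D.+1 * #|~: Y|.
    rewrite card_setIX exchange_big /= mulnC -sum_nat_const; apply: leq_sum => b _.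
    rewrite -(cF b) /cdeg big_mkcond /=; apply: leq_sum => a _; by case: (a \in X).
  rewrite !mul1n -(cardsC Y); move: e le.
  move: #|X| #|F :&: setX X Y| #|F :&: setX X (~: Y)| #|Y| #|~: Y| => x s s' y z.
  clear; nia.
have [m mF1] := regular1_perm rF1 cF1.
have [||ms [sz msF pw]] := IH (F :\: F1).
- by move=> a; have := rF a; rewrite (rdegB _ F1F) rF1 => -[].
- by move=> b; have := cF b; rewrite (cdegB _ F1F) cF1 => -[].
exists (m :: ms); split; first by rewrite /= sz.
- move=> m'; rewrite in_cons => /orP[/eqP ->|/msF h] a; first exact: (subsetP F1F).
  by have /setDP[] := h a.
rewrite /= pw andbT; apply/allP => m' /msF h; apply/forallP => a.
by apply: contraTneq (h a) => <-; rewrite inE mF1.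
Qed.
End Matchings.

(** * Expansion of pseudorandom bipartite graphs *)

Section Pseudorandom.
Local Open Scope ring_scope.
Variable R : realFieldType.

Lemma sqr_sum_le (I : finType) (Y : {set I}) (d : I -> R) :
  (\sum_(i in Y) d i) ^+ 2 <= #|Y|%:R * \sum_(i in Y) d i ^+ 2.
Proof.
rewrite expr2 big_distrlr /= -(ler_pMn2r (_ : 0 < 2)%N) //.
have -> : (#|Y|%:R * \sum_(i in Y) d i ^+ 2) *+ 2 =
   \sum_(i in Y) \sum_(j in Y) (d i ^+ 2 + d j ^+ 2).
  under [RHS]eq_bigr do rewrite big_split /= sumr_const.
  by rewrite big_split /= sumr_const sumrMnl mulr_natl mulr2n.
rewrite -sumrMnl; apply: ler_sum => i _; rewrite -sumrMnl; apply: ler_sum => j _.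
by have := sqr_ge0 (d i - d j); rewrite sqrrB; lra.
Qed.

Variables A B : finType.
Variable G : {set A * B}.
Implicit Types (X : {set A}) (Y : {set B}).

Definition ecount X Y := #|G :&: setX X Y|.

Definition codeg a a' := #|[set b | ((a, b) \in G) && ((a', b) \in G)]|.

Lemma ecountE X Y : ecount X Y = (\sum_(a in X) \sum_(b in Y) ((a, b) \in G))%N.
Proof. exact: card_setIX. Qed.

Lemma ecountC X Y : (ecount X Y + ecount X (~: Y) = ecount X setT)%N.
Proof.
rewrite !ecountE -big_split /=; apply: eq_bigr => a _.
rewrite [RHS](bigID (mem Y)) /=.
by congr (_ + _)%N; apply: eq_bigl => b; rewrite !inE.
Qed.

Lemma ecount_rdeg X : ecount X setT = (\sum_(a in X) rdeg G a)%N.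
Proof.
by rewrite ecountE; apply: eq_bigr => a _; apply: eq_bigl => b; rewrite inE.
Qed.

Lemma ecount_cdeg Y : ecount setT Y = (\sum_(b in Y) cdeg G b)%N.
Proof.
rewrite ecountE exchange_big; apply: eq_bigr => b _.
by apply: eq_bigl => a; rewrite inE.
Qed.

(** Expanding the square counts pairs of rows of [X] with a common neighbour in [Y]: the diagonal
    pairs contribute the edge count, the others at most a codegree each. *)
Lemma ecount_sqr X Y (C : R) :
  (forall a a', a != a' -> (codeg a a')%:R <= C) -> 0 <= C ->
  \sum_(b in Y) ((\sum_(a in X) ((a, b) \in G))%N%:R : R) ^+ 2 <=
     (ecount X Y)%:R + #|X|%:R ^+ 2 * C.
Proof.
move=> hC C0.
have -> : \sum_(b in Y) ((\sum_(a in X) ((a, b) \in G))%N%:R : R) ^+ 2 =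
   \sum_(a in X) \sum_(a' in X) (\sum_(b in Y) ((a, b) \in G) * ((a', b) \in G))%N%:R.
  under eq_bigr do rewrite natr_sum expr2 big_distrlr /=.
  rewrite exchange_big /=; apply: eq_bigr => a _.
  rewrite exchange_big /=; apply: eq_bigr => a' _.
  by rewrite natr_sum; apply: eq_bigr => b _; rewrite natrM.
rewrite ecountE natr_sum expr2 -mulrA.
have -> : #|X|%:R * (#|X|%:R * C) = \sum_(a in X) \sum_(a' in X) C.
  by rewrite !sumr_const -[in RHS]mulr_natl -[in RHS](mulr_natl C).
rewrite -big_split /=; apply: ler_sum => a aX.
rewrite (bigD1 a) //= [X in _ <= _ + X](bigD1 a) //= addrA; apply: lerD.
  rewrite -[leLHS]addr0 lerD // ler_nat; apply: leq_sum => b _.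
  by case: (_ \in _).
apply: ler_sum => a' /andP[_ aa']; apply: le_trans (hC a a' _); last by rewrite eq_sym.
rewrite ler_nat /codeg -sum1_card [X in (_ <= X)%N]big_mkcond [X in (X <= _)%N]big_mkcond /=.
by apply: leq_sum => b _; rewrite inE; do 3!case: (_ \in _).
Qed.

End Pseudorandom.

(** * Numerical core of the expansion estimates *)

Section Expansion.
Local Open Scope ring_scope.
Variable R : realFieldType.

(* Here [f = e(X, Y)], [E = e(X, B)], [x = #|X|], [y = #|Y|] and [z = nu - y].  The bounds on
   [f] and [E - f] are Cauchy-Schwarz for the degrees into [X] over [Y] and its complement; they
   are combined around the mean of these degrees, since the uncentred bound is too weak when
   [y] is close to [nu]. *)
Lemma expansion_large (f E x y z nu d eta beta Qy Qz : R) :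
  y + z = nu -> 0 < y -> 0 <= z -> z <= y -> 0 <= x ->
  0 < eta -> eta <= 5 / 32 -> 0 < beta -> 3 * eta <= beta ^+ 2 -> 0 < d ->
  nu <= eta ^+ 2 * beta * d ^+ 2 -> beta * d < x -> (1 - eta) * d * x <= E ->
  f ^+ 2 <= y * Qy -> (E - f) ^+ 2 <= z * Qz ->
  nu * (Qy + Qz) <= nu * E + x ^+ 2 * ((1 + eta) * d ^+ 2) ->
  (1 - eta - beta) * d * x * y <= nu * f.
Proof.
move=> yz y0 z0 zy x0 eta0 eta1 b0 b3 d0 nud xb E0 fy fz Q.
rewrite leNgt; apply/negP => lt.
pose D := (1 - eta - beta) * d.
have nu0 : 0 < nu by lra.
pose N := nu * E + x ^+ 2 * ((1 + eta) * d ^+ 2) - E ^+ 2.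
have dx0 : 0 < d * x by rewrite mulr_gt0 //; apply: le_lt_trans xb; rewrite mulr_ge0 ?ltW.
(* Up to the factors [y], [z] and [nu] this is the variance of the degrees into [X], split between
   [Y] and its complement and centred at the mean [E / nu]. *)
have h1 : (y * E - nu * f) ^+ 2 <= y * z * N.
  have -> : (y * E - nu * f) ^+ 2 = nu * (z * f ^+ 2 + y * (E - f) ^+ 2) - y * z * E ^+ 2.
    by rewrite -yz; ring.
  rewrite /N mulrBr lerD2r; apply: (@le_trans _ _ (nu * (y * z * (Qy + Qz)))).
    rewrite ler_pM2l // mulrDr; apply: lerD.
      by rewrite [y * z]mulrC -mulrA ler_wpM2l.
    by rewrite -mulrA ler_wpM2l // ltW.
  by rewrite mulrCA ler_wpM2l // mulr_ge0 // ltW.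
have ED : 0 < E - D * x.
  have : 0 < beta * (d * x) by rewrite mulr_gt0.
  by rewrite /D; move: E0; lra.
have h2 : (y * (E - D * x)) ^+ 2 < y * z * N.
  apply: lt_le_trans h1; rewrite ltr_pXn2r ?nnegrE //; last first.
  - by have : D * x * y < y * E; [rewrite mulrC ltr_pM2l; lra | rewrite /D; lra].
  - by rewrite mulr_ge0 // ltW.
  by rewrite /D; lra.
have N0 : 0 < N.
  rewrite ltNge; apply/negP => N0; have := le_lt_trans (sqr_ge0 _) h2.
  by rewrite ltNge mulr_ge0_le0 // mulr_ge0 // ltW.
have h3 : (E - D * x) ^+ 2 < N.
  have : (y * (E - D * x)) ^+ 2 < y ^+ 2 * N.
    by apply: lt_le_trans h2 _; rewrite expr2 ler_pM2r // ler_pM2l.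
  by rewrite exprMn ltr_pM2l // exprn_gt0.
pose u := E - (1 - eta) * d * x.
have u0 : 0 <= u by rewrite /u; lra.
have db : beta * d ^+ 2 <= d * x.
  by rewrite expr2 mulrA mulrC ler_pM2l // ltW.
have nx : nu <= eta ^+ 2 * (d * x).
  by apply: le_trans nud _; rewrite -mulrA ler_wpM2l // sqr_ge0.
have nx2 : nu * 4 <= d * x.
  have : eta ^+ 2 <= 1 / 4 by rewrite expr2; nra.
  by move=> h; move: (ler_wpM2r (ltW dx0) h); lra.
have k1 : 0 <= (d * x) * (eta ^+ 2 * (d * x) - nu) by rewrite mulr_ge0 ?subr_ge0 // ltW.
have k2 : 0 <= (d * x) ^+ 2 * (beta ^+ 2 - 3 * eta).
  by rewrite mulr_ge0 ?sqr_ge0 // subr_ge0.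
have k3 : 0 <= u * (2 * (1 - eta) * (d * x) + 2 * beta * (d * x) - nu).
  rewrite mulr_ge0 //; have : 0 < beta * (d * x) by rewrite mulr_gt0.
  have : eta * (d * x) <= 5 / 32 * (d * x) by rewrite ler_pM2r.
  by lra.
have k4 : 0 <= eta * (d * x) * nu by rewrite !mulr_ge0 // ltW.
have k5 := sqr_ge0 u.
(* The coefficient of [(d * x) ^ 2] is [(1 + eta) - (1 - eta) ^ 2 - beta ^ 2], the origin of the
   condition [3 * eta <= beta ^ 2]. The spare [eta ^ 2] absorbs the diagonal term containing
   [nu]. *)
suff : N - (E - D * x) ^+ 2 = - (d * x) * (eta ^+ 2 * (d * x) - nu)
   - (d * x) ^+ 2 * (beta ^+ 2 - 3 * eta)
   - u * (2 * (1 - eta) * (d * x) + 2 * beta * (d * x) - nu)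
   - eta * (d * x) * nu - 2 * u ^+ 2 by lra.
by rewrite /N /D /u; ring.
Qed.

(* Here [g] counts the edges between [Y] and the complement of [X], of size [x], and [e] all
   edges at [Y]; plain Cauchy-Schwarz for [g] suffices when [Y] has at most half of the vertices. *)
Lemma expansion_small (g e x y nu d eta beta : R) :
  0 <= x -> x < y -> 2 * y <= nu ->
  0 < eta -> eta <= 5 / 32 -> 0 < beta -> beta <= 1 - eta -> 0 < d -> 10 <= beta * d ->
  (1 - eta) * d * y <= e ->
  nu * g ^+ 2 <= y * (nu * g + x ^+ 2 * ((1 + eta) * d ^+ 2)) ->
  (1 - eta - beta) * d * (y - x) <= e - g.
Proof.
move=> x0 xy yn eta0 eta1 b0 b1 d0 bd e0 gle; rewrite leNgt; apply/negP => lt.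
pose D := (1 - eta - beta) * d.
have y0 : 0 < y by lra.
have bdy : 10 * y <= beta * d * y by rewrite ler_pM2r.
have g1 : beta * d * y + D * x < g by rewrite /D; move: lt e0; lra.
have bdx : beta * d * x <= beta * d * y by rewrite ler_wpM2l //; lra.
have g2 : (1 - eta) * (d * x) < g by move: g1 bdx; rewrite /D; lra.
have dx : 0 <= d * x by rewrite mulr_ge0 // ltW.
have g0 : 0 < g by apply: le_lt_trans g2; rewrite mulr_ge0 //; lra.
have g3 : 10 * y <= g.
  have : 0 <= D * x by rewrite mulr_ge0 // mulr_ge0 ?(ltW d0) //; lra.
  by lra.
(* As [beta * d] is at least 10, the diagonal term costs at most a tenth of [g ^ 2]. What is left
   contradicts [g2]: for [eta <= 5 / 32] one has [1 - eta >= 27 / 32] and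
   [(1 + eta) / 2 <= 37 / 64], while [9 / 10 * (27 / 32) ^ 2] exceeds [37 / 64]. *)
have k1 : y * g * 10 <= g ^+ 2.
  by rewrite expr2 mulrAC ler_pM2r // mulrC.
have k2 : nu * (g ^+ 2 * 9 / 10) <= nu * ((1 + eta) / 2 * (d * x) ^+ 2).
  have : nu * (y * g * 10) <= nu * g ^+ 2 by rewrite ler_pM2l //; lra.
  have : 2 * y * ((1 + eta) * (d * x) ^+ 2) <= nu * ((1 + eta) * (d * x) ^+ 2).
    by rewrite ler_wpM2r // mulr_ge0 ?sqr_ge0 //; lra.
  rewrite exprMn; move: gle; lra.
have k3 : g ^+ 2 * 9 / 10 <= (1 + eta) / 2 * (d * x) ^+ 2.
  by rewrite -(ler_pM2l (_ : 0 < nu)) //; lra.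
have k4 : (27 / 32 * (d * x)) ^+ 2 <= g ^+ 2.
  rewrite ler_pXn2r ?nnegrE // ?(ltW g0) //; last by lra.
  have : eta * (d * x) <= 5 / 32 * (d * x) by rewrite ler_wpM2r.
  by move: g2; lra.
have k5 : eta * (d * x) ^+ 2 <= 5 / 32 * (d * x) ^+ 2 by rewrite ler_wpM2r ?sqr_ge0.
have k6 := sqr_ge0 (d * x); have k7 : 0 < g ^+ 2 by rewrite exprn_gt0.
by move: k4; rewrite exprMn; move: k3 k5 k6 k7; lra.
Qed.

End Expansion.

(** * Disjoint perfect matchings in a pseudorandom bipartite graph *)

Section PerfectMatchings.
Local Open Scope ring_scope.
Variables (R : realFieldType) (I : finType) (G : {set I * I}) (d eta beta : R) (D : nat).
Hypotheses (eta0 : 0 < eta) (eta1 : eta <= 5 / 32) (beta0 : 0 < beta)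
  (beta1 : beta <= 1 - eta) (eta_beta : 3 * eta <= beta ^+ 2) (d0 : 0 < d)
  (nud : #|I|%:R <= eta ^+ 2 * beta * d ^+ 2) (bd : 10 <= beta * d)
  (hD : D%:R <= (1 - eta - beta) * d)
  (hr : forall a, (1 - eta) * d <= (rdeg G a)%:R)
  (hc : forall b, (1 - eta) * d <= (cdeg G b)%:R)
  (hcodeg : forall a a', a != a' ->
     (codeg G a a')%:R * #|I|%:R <= (1 + eta) * d ^+ 2).

(** Only [#|X| + #|Y| > #|I|] needs work. If [Y] has at most half of the columns, [expansion_small]
    applies. Otherwise, if [X] has at most [beta * d] rows, each of them loses fewer than [beta * d]
    neighbours outside [Y], since [#|~: Y| < #|X|]. For larger [X], [expansion_large] gives the
    share [#|X| * #|Y| / nu], which is at least [#|X| + #|Y| - nu] because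
    [(nu - #|X|) * (nu - #|Y|)] is nonnegative. *)
Lemma pseudorandom_expansion (X Y : {set I}) :
  (D * (#|X| + #|Y|) <= #|G :&: setX X Y| + D * #|I|)%N.
Proof.
have [I0|I0] := posnP #|I|.
  have := max_card (mem X); have := max_card (mem Y); rewrite I0 !leqn0.
  by move=> /eqP -> /eqP ->; rewrite muln0.
have [XY|XY] := leqP (#|X| + #|Y|) #|I|.
  by rewrite (leq_trans _ (leq_addl _ _)) // leq_mul2l XY orbT.
set nu : R := #|I|%:R; have nu0 : 0 < nu by rewrite ltr0n.
pose C := (1 + eta) * d ^+ 2 / nu.
have C0 : 0 <= C by rewrite divr_ge0 ?(ltW nu0) // mulr_ge0 ?sqr_ge0 //; move: eta0; lra.
have hC a a' : a != a' -> (codeg G a a')%:R <= C.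
  by move=> /hcodeg h; rewrite /C ler_pdivlMr.
have nuC : nu * C = (1 + eta) * d ^+ 2 by rewrite /C mulrC divfK // gt_eqF.
have cauchy (X' Y' : {set I}) : (ecount G X' Y')%:R ^+ 2 <=
    #|Y'|%:R * (\sum_(b in Y') ((\sum_(a in X') ((a, b) \in G))%N%:R : R) ^+ 2).
  by apply: le_trans (sqr_sum_le _ _); rewrite ecountE exchange_big /= natr_sum.
have dmin (X' : {set I}) : (1 - eta) * d * #|X'|%:R <= (ecount G X' setT)%:R.
  rewrite ecount_rdeg natr_sum mulr_natr -sumr_const.
  by apply: ler_sum => a _.
rewrite -(ler_nat R) natrD -/(ecount G X Y) !natrM natrD -/nu.
have cX := cardsC X; have cY := cardsC Y.
have {cX} cX : #|X|%:R + #|~: X|%:R = nu by rewrite -natrD cX.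
have {cY} cY : #|Y|%:R + #|~: Y|%:R = nu by rewrite -natrD cY.
have {}XY : nu < #|X|%:R + #|Y|%:R by rewrite -natrD ltr_nat.
have x0 : 0 <= #|X|%:R :> R by []. have y0 : 0 <= #|Y|%:R :> R by [].
have x'0 : 0 <= #|~: X|%:R :> R by []. have y'0 : 0 <= #|~: Y|%:R :> R by [].
suff h : (1 - eta - beta) * d * (#|X|%:R + #|Y|%:R - nu) <= (ecount G X Y)%:R.
  rewrite -lerBlDr -mulrBr; apply: le_trans h; rewrite ler_wpM2r //.
  by rewrite subr_ge0 ltW.
have D0 : 0 <= (1 - eta - beta) * d by rewrite mulr_ge0 ?(ltW d0) //; move: beta1; lra.
have EX := ecountC G X Y; have {EX} EX : (ecount G X Y)%:R + (ecount G X (~: Y))%:R = (ecount G X setT)%:R :> R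
  by rewrite -natrD EX.
have [y2|y2] := lerP (2 * #|Y|%:R) nu.
  have -> : #|X|%:R + #|Y|%:R - nu = #|Y|%:R - #|~: X|%:R by lra.
  have EY : (ecount G X Y)%:R = (ecount G setT Y)%:R - (ecount G (~: X) Y)%:R :> R.
    apply/eqP; rewrite eq_sym subr_eq -natrD; apply/eqP; congr (_%:R).
    rewrite !ecountE [LHS](bigID (mem X)) /=.
    by congr (_ + _)%N; apply: eq_bigl => b; rewrite !inE.
  rewrite EY; apply: (expansion_small (nu := nu)) => //; first by lra.
    rewrite ecount_cdeg natr_sum mulr_natr -sumr_const.
    by apply: ler_sum => b _.
  apply: le_trans (ler_wpM2l (ltW nu0) (cauchy _ _)) _.
  rewrite mulrCA ler_wpM2l //.
  apply: le_trans (ler_wpM2l (ltW nu0) (ecount_sqr _ _ hC C0)) _.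
  by rewrite mulrDr [nu * (_ * _)]mulrCA nuC.
have [xs|xb] := lerP #|X|%:R (beta * d).
  have zX : (ecount G X (~: Y))%:R <= #|X|%:R * #|~: Y|%:R :> R.
    by rewrite -natrM ler_nat -cardsX subset_leq_card // subsetIr.
  have := dmin X; have : #|X|%:R * #|~: Y|%:R <= #|X|%:R * (beta * d).
    by rewrite ler_wpM2l //; lra.
  have : (1 - eta - beta) * d * (#|X|%:R + #|Y|%:R - nu) <= (1 - eta - beta) * d * #|X|%:R.
    by rewrite ler_wpM2l //; lra.
  by move: EX zX; lra.
apply: (@le_trans _ _ ((1 - eta - beta) * d * #|X|%:R * #|Y|%:R / nu)).
  rewrite ler_pdivlMr // -!mulrA ler_wpM2l //; first by move: beta1; lra.
  rewrite ler_wpM2l ?(ltW d0) //.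
  have : 0 <= #|~: X|%:R * #|~: Y|%:R :> R by rewrite mulr_ge0.
  have -> : #|~: X|%:R = nu - #|X|%:R by lra.
  have -> : #|~: Y|%:R = nu - #|Y|%:R by lra.
  by lra.
rewrite ler_pdivrMr // [leRHS]mulrC.
have le1 : (1 - eta) * d * #|X|%:R <= (ecount G X setT)%:R := dmin X.
apply: (expansion_large cY _ y'0 _ x0 eta0 eta1 beta0 eta_beta d0 nud xb le1
   (cauchy X Y)).
- by lra.
- by lra.
- by rewrite -EX addrAC subrr add0r; exact: cauchy.
rewrite -nuC [_ ^+ 2 * _]mulrCA -mulrDr ler_pM2l //.
apply: le_trans (ecount_sqr X [set: I] hC C0); rewrite [leRHS](bigID (mem Y)) /=.
by rewrite le_eqVlt; apply/orP; left; apply/eqP; congr (_ + _);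
   apply: eq_bigl => b; rewrite !inE.
Qed.

Lemma pseudorandom_matchings : exists ms : seq {perm I}, [/\ size ms = D,
    forall m, m \in ms -> forall a, (a, m a) \in G &
    pairwise (fun m m' : {perm I} => [forall a, m a != m' a]) ms].
Proof.
have [F [FG rF cF]] := bipartite_factor erefl pseudorandom_expansion.
have [ms [sz msF pw]] := regular_matchings rF cF.
by exists ms; split=> // m mms a; apply: (subsetP FG); exact: msF.
Qed.

End PerfectMatchings.
(** * Random colourings *)

Bind Scope ring_scope with R.
Arguments exp x%_ring_scope.

(** * Elementary bounds for the exponential *)

Section ExpBounds.
Local Open Scope ring_scope.

Lemma expD (x y : R) : exp (x + y) = exp x * exp y.
Proof. exact: exp_plus. Qed.

Lemma exp0 : exp 0 = 1.
Proof. exact: exp_0. Qed.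

Lemma exp_gt0 (x : R) : 0 < exp x.
Proof. by apply/RltP; exact: exp_pos. Qed.

Lemma exp_ge1Dx (x : R) : 1 + x <= exp x.
Proof. by apply/RleP; exact: exp_ineq1_le. Qed.

Lemma ler_exp (x y : R) : x <= y -> exp x <= exp y.
Proof.
rewrite le_eqVlt => /orP[/eqP -> //|/RltP xy].
by apply/RleP/Rlt_le; exact: exp_increasing.
Qed.

Lemma expMn (x : R) n : exp (x *+ n) = exp x ^+ n.
Proof. by rewrite expRX. Qed.

Lemma expV (x : R) : exp (- x) = (exp x)^-1.
Proof. exact: exp_Ropp. Qed.

Lemma exp_le_quadratic (x : R) : x <= 1 / 3 -> exp x <= 1 + x + x ^+ 2.
Proof.
move=> x3.
have h := exp_ge1Dx (- (x / 2)).
have p : 0 < 1 - x / 2 by lra.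
have e0 := exp_gt0 (- (x / 2)).
have e1 : exp x * exp (- (x / 2)) ^+ 2 = 1.
  by rewrite expr2 -!expD -[RHS]exp0; congr exp; lra.
have q0 : 0 < 1 + x + x ^+ 2 by have := sqr_ge0 (x + 1 / 2); lra.
have q : 1 <= (1 + x + x ^+ 2) * (1 - x / 2) ^+ 2.
  have : 0 <= x ^+ 2 * (1 - 3 * x + x ^+ 2).
    by rewrite mulr_ge0 ?sqr_ge0 //; have := sqr_ge0 x; lra.
  by lra.
have q2 : (1 - x / 2) ^+ 2 <= exp (- (x / 2)) ^+ 2.
  by rewrite ler_pXn2r ?nnegrE ?(ltW p) ?(ltW e0).
rewrite -(ler_pM2r (exprn_gt0 2 e0)) e1.
by apply: le_trans q _; rewrite ler_pM2l.
Qed.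

Lemma exp_le_1D (x : R) : 0 <= x -> x <= 1 / 3 -> exp (x - x ^+ 2) <= 1 + x.
Proof.
move=> x0 x3; have h := sqr_ge0 x.
apply: le_trans (exp_le_quadratic _) _; first by lra.
have -> : 1 + x = 1 + (x - x ^+ 2) + (x - x ^+ 2) ^+ 2 + x ^+ 3 * (2 - x) by ring.
by rewrite lerDl mulr_ge0 ?exprn_ge0 //; lra.
Qed.

Lemma exp_le_1B (x : R) : 0 <= x -> x <= 1 / 8 -> exp (- (x + 2 * x ^+ 2)) <= 1 - x.
Proof.
move=> x0 x3; have h := sqr_ge0 x.
apply: le_trans (exp_le_quadratic _) _; first by lra.
have h2 : 0 <= x ^+ 2 * (1 - 4 * x - 4 * x ^+ 2).
  have xx : x * x <= x * (1 / 8) by rewrite ler_wpM2l.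
  by rewrite mulr_ge0 //; lra.
by lra.
Qed.

Lemma expXn_le (x : R) n : 0 <= 1 + x -> (1 + x) ^+ n <= exp (x * n%:R).
Proof.
move=> x0; rewrite mulr_natr expMn; apply: lerXn2r; rewrite ?nnegrE //.
  by rewrite ltW // exp_gt0.
exact: exp_ge1Dx.
Qed.
End ExpBounds.

(** * Generating function of the number of correctly coloured sets *)

Section Colouring.
Local Open Scope ring_scope.
Variables (E I : finType) (K : nat) (c : E -> 'I_K) (P : I -> {set E}) (S : {set I}) (w : nat).
Hypothesis K0 : (0 < K)%N.
Hypothesis cardP : forall i, i \in S -> #|P i| = w.
Hypothesis disjP : forall i j, i \in S -> j \in S -> i != j -> [disjoint P i & P j].

Definition agree (Q : {set E}) (phi : {ffun E -> 'I_K}) := [forall e in Q, phi e == c e].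

Lemma card_agree Q : #|[set phi | agree Q phi]| = (K ^ (#|E| - #|Q|))%N.
Proof.
have -> : #|[set phi | agree Q phi]| =
    #|family (fun e => if e \in Q then pred1 (c e) else predT)|.
  apply: eq_card => phi; rewrite inE; apply/forallP/familyP => h e.
    by have := h e; case: (e \in Q) => //= /eqP ->; rewrite inE.
  by apply/implyP => eQ; have := h e; rewrite eQ inE.
rewrite card_family foldrE big_map big_enum /= (bigID (mem Q)) /=.
rewrite big1 => [|e eQ]; last by rewrite eQ card1.
rewrite mul1n (eq_bigr (fun=> K)) => [|e /negPf ->]; last by rewrite cardT size_enum_ord.
rewrite prod_nat_const; congr (_ ^ _)%N.
rewrite -(cardsC Q) addKn; apply: eq_card => e; by rewrite !inE.
Qed.

Lemma card_bigcup_P (J : {set I}) : J \subset S -> #|\bigcup_(i in J) P i| = (#|J| * w)%N.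
Proof.
move=> /subsetP JS.
rewrite big_mkcond -sum1_card /=.
rewrite partition_disjoint_bigcup => [|i j ij].
  rewrite -sum_nat_const [RHS]big_mkcond; apply: eq_bigr => i _.
  by rewrite sum1_card; case: ifP => iJ; rewrite ?cards0 // cardP // JS.
case: ifP => iJ; last by rewrite -setI_eq0 set0I.
case: ifP => jJ; last by rewrite -setI_eq0 setI0.
by apply: disjP => //; exact: JS.
Qed.

Definition hits (phi : {ffun E -> 'I_K}) := #|[set i in S | agree (P i) phi]|.

(** Disjoint sets are coloured independently and each agrees with the prescription with probability
    [1 / K ^ w], so this is the generating function of a binomial law. Independence appears by
    expanding both sides over subsets [J] of the indices and counting the colourings that agree on
    the union over [J]. *)
Lemma colouring_mgf (mu : R) :
  \sum_phi (1 + mu) ^+ hits phi = K%:R ^+ #|E| * (1 + mu / K%:R ^+ w) ^+ #|S|.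
Proof.
have K1 : K%:R != 0 :> R by rewrite pnatr_eq0 -lt0n.
pose m i := if i \in S then mu else 0.
have -> : (1 + mu / K%:R ^+ w) ^+ #|S| = \prod_i (m i / K%:R ^+ w + 1).
  rewrite -prodr_const big_mkcond; apply: eq_bigr => i _.
  by rewrite /m; case: ifP => _; rewrite ?mul0r ?add0r // addrC.
rewrite bigA_distr mulr_sumr.
have -> : \sum_phi (1 + mu) ^+ hits phi =
   \sum_phi \sum_(J : {set I}) \prod_i (if i \in J then m i * (agree (P i) phi)%:R else 1).
  apply: eq_bigr => phi _; rewrite -bigA_distr -prodr_const big_mkcond.
  apply: eq_bigr => i _; rewrite inE /m; case: (i \in S) => /=; last by rewrite mul0r add0r.
  by case: agree; rewrite ?mulr1 ?mulr0 ?add0r // addrC.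
rewrite exchange_big; apply: eq_bigr => J _ /=.
have [JS|/subsetPn[i iJ iS]] := boolP (J \subset S); last first.
  rewrite big1 => [|phi _]; last by rewrite (bigD1 i) //= iJ /m (negPf iS) !mul0r.
  by rewrite (bigD1 i) //= iJ /m (negPf iS) !mul0r mulr0.
rewrite -!big_mkcond /=.
have -> : \prod_(i in J) (m i / K%:R ^+ w) = mu ^+ #|J| / K%:R ^+ (#|J| * w).
  rewrite (eq_bigr (fun=> mu / K%:R ^+ w)) => [|i iJ]; last by rewrite /m (subsetP JS).
  by rewrite prodr_const expr_div_n -exprM mulnC.
transitivity (\sum_phi mu ^+ #|J| * (agree (\bigcup_(i in J) P i) phi)%:R).
  apply: eq_bigr => phi _; rewrite -big_mkcond big_split /=; congr (_ * _).
    rewrite -prodr_const; apply: eq_bigr => i iJ; by rewrite /m (subsetP JS).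
  rewrite -natr_prod; congr (_%:R).
  have [/forall_inP h|/forall_inPn[e /bigcupP[i iJ eP] ne]] := boolP (agree _ phi).
    rewrite big1 // => i iJ; suff -> : agree (P i) phi by [].
    by apply/forall_inP => e eP; apply: h; apply/bigcupP; exists i.
  rewrite (bigD1 i) //=; suff /negPf -> : ~~ agree (P i) phi by rewrite mul0n.
  by apply/forall_inPn; exists e.
rewrite -mulr_sumr mulrCA; congr (_ * _).
rewrite -natr_sum; have -> : (\sum_phi agree (\bigcup_(i in J) P i) phi)%N =
   #|[set phi | agree (\bigcup_(i in J) P i) phi]|.
  by rewrite -sum1_card [RHS]big_mkcond; apply: eq_bigr => phi _; rewrite inE; case: agree.
rewrite card_agree card_bigcup_P // natrX -exprB ?unitfE //.
by rewrite -card_bigcup_P // max_card.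
Qed.

End Colouring.

(** * Markov inequality and union bound by counting *)

Section Markov.
Local Open Scope ring_scope.
Variable T : finType.

Lemma markov_card (F : T -> R) (B : {set T}) (a : R) :
  (forall x, 0 <= F x) -> (forall x, x \in B -> a <= F x) ->
  #|B|%:R * a <= \sum_x F x.
Proof.
move=> F0 aF; rewrite mulr_natl -sumr_const [leRHS](bigID (mem B)) /=.
by rewrite -[leLHS]addr0 lerD ?sumr_ge0 //; apply: ler_sum.
Qed.

Lemma exists_avoiding (U : finType) (bad : U -> {set T}) (delta : R) :
  (0 < #|T|)%N -> (forall u, #|bad u|%:R <= #|T|%:R * delta) ->
  #|U|%:R * delta < 1 -> exists x, forall u, x \notin bad u.
Proof.
move=> T0 hbad dU; have [x xU|h] := pickP [pred x | [forall u, x \notin bad u]].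
  by exists x => u; move: xU => /forallP.
have : #|T|%:R <= \sum_u #|bad u|%:R :> R.
  rewrite -natr_sum ler_nat -sum1_card.
  under [X in (_ <= X)%N]eq_bigr do rewrite -sum1_card big_mkcond.
  rewrite exchange_big; apply: leq_sum => x _.
  have /negbT/forallPn[u] := h x; rewrite negbK => xu.
  by rewrite (bigD1 u) //= xu.
have : \sum_u #|bad u|%:R <= \sum_(u : U) (#|T|%:R * delta) by apply: ler_sum.
rewrite sumr_const => h1 h2; have := le_trans h2 h1.
by rewrite -(mulr_natl (#|T|%:R * delta)) mulrCA leNgt gtr_pMr ?dU // ltr0n.
Qed.
End Markov.

(** * Chernoff bounds for random colourings *)

Section ColouringTails.
Local Open Scope ring_scope.
Variables (E I : finType) (K : nat) (c : E -> 'I_K) (P : I -> {set E}) (S : {set I}) (w : nat).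
Hypothesis K0 : (0 < K)%N.
Hypothesis cardP : forall i, i \in S -> #|P i| = w.
Hypothesis disjP : forall i j, i \in S -> j \in S -> i != j -> [disjoint P i & P j].
Variable tau : R.
Hypotheses (tau0 : 0 <= tau) (tau1 : tau <= 1 / 2).

Let Kw : 0 < K%:R ^+ w :> R. Proof. by rewrite exprn_gt0 // ltr0n. Qed.

Let card_colourings : #|{ffun E -> 'I_K}|%:R = K%:R ^+ #|E| :> R.
Proof. by rewrite card_ffun card_ord natrX. Qed.

(** Markov applied to [colouring_mgf] with [mu = - tau / 4]. A value nearer to [- tau] would improve
    only the constant 8 in the exponent; this one stays within the range [1 / 8] of [exp_le_1B]. *)
Lemma hits_lower (L : R) : 0 <= L -> L * K%:R ^+ w <= #|S|%:R ->
  #|[set phi | (hits c P S phi)%:R < (1 - tau) * L]|%:R <=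
    #|{ffun E -> 'I_K}|%:R * exp (- (L * tau ^+ 2 / 8)).
Proof.
move=> L0 LS; pose m := tau / 4; have [t0 t1] := (tau0, tau1).
have m0 : 0 <= m by rewrite /m; lra.
have m8 : m <= 1 / 8 by rewrite /m; lra.
pose s := (m + 2 * m ^+ 2) * ((1 - tau) * L).
have := @markov_card _ (fun phi => (1 - m) ^+ hits c P S phi)
  [set phi | (hits c P S phi)%:R < (1 - tau) * L] (exp (- s)).
rewrite (colouring_mgf c K0 cardP disjP) => h.
rewrite -(ler_pM2r (exp_gt0 (- s))); apply: le_trans (h _ _) _.
- by move=> phi; rewrite exprn_ge0 //; lra.
- move=> phi; rewrite inE => lt;
  apply: (@le_trans _ _ (exp (- (m + 2 * m ^+ 2)) ^+ hits c P S phi)).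
    rewrite -expMn; apply: ler_exp; rewrite mulNrn lerN2 -(mulr_natr (m + 2 * m ^+ 2)).
    by rewrite /s ler_wpM2l ?(ltW lt) //; have := sqr_ge0 m; lra.
  rewrite lerXn2r ?nnegrE ?(ltW (exp_gt0 _)) //; first by lra.
  exact: exp_le_1B.
rewrite -card_colourings -[leRHS]mulrA ler_wpM2l // -expD.
have d : m / K%:R ^+ w <= 1 / 8.
  apply: le_trans m8; rewrite ler_pdivrMr // ler_peMr //.
  by rewrite exprn_ege1 // ler1n.
apply: le_trans (expXn_le _ _) _; first by rewrite mulNr; lra.
apply: ler_exp; rewrite mulNr mulNr.
have : m * L <= m / K%:R ^+ w * #|S|%:R.
  by rewrite -mulrA ler_wpM2l // mulrC ler_pdivlMr.
have : 0 <= m ^+ 2 * tau * L by rewrite mulr_ge0 // mulr_ge0 // sqr_ge0.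
by rewrite /s /m; lra.
Qed.

Lemma hits_upper (u : R) : 0 <= u -> #|S|%:R <= u * K%:R ^+ w ->
  #|[set phi | (1 + tau) * u < (hits c P S phi)%:R]|%:R <=
    #|{ffun E -> 'I_K}|%:R * exp (- (u * tau ^+ 2 / 8)).
Proof.
move=> u0 uS; pose m := tau / 4; have [t0 t1] := (tau0, tau1).
have m0 : 0 <= m by rewrite /m; lra.
have m8 : m <= 1 / 8 by rewrite /m; lra.
have mm : m ^+ 2 <= m * (1 / 8) by rewrite expr2 ler_wpM2l.
pose s := (m - m ^+ 2) * ((1 + tau) * u).
have := @markov_card _ (fun phi => (1 + m) ^+ hits c P S phi)
  [set phi | (1 + tau) * u < (hits c P S phi)%:R] (exp s).
rewrite (colouring_mgf c K0 cardP disjP) => h.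
rewrite -(ler_pM2r (exp_gt0 s)); apply: le_trans (h _ _) _.
- by move=> phi; rewrite exprn_ge0 //; lra.
- move=> phi; rewrite inE => lt; apply: (@le_trans _ _ (exp (m - m ^+ 2) ^+ hits c P S phi)).
    rewrite -expMn; apply: ler_exp; rewrite -(mulr_natr (m - m ^+ 2)).
    by rewrite /s ler_wpM2l ?(ltW lt) //; lra.
  rewrite lerXn2r ?nnegrE ?(ltW (exp_gt0 _)) //; first by lra.
  by apply: exp_le_1D => //; lra.
rewrite -card_colourings -[leRHS]mulrA ler_wpM2l // -expD.
apply: le_trans (expXn_le _ _) _.
  by have : 0 <= m / K%:R ^+ w; [rewrite divr_ge0 // ltW | lra].
apply: ler_exp.
have : m / K%:R ^+ w * #|S|%:R <= m * u.
  by rewrite -mulrA ler_wpM2l // mulrC ler_pdivrMr.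
have : tau * (tau ^+ 2 * u) <= 1 / 2 * (tau ^+ 2 * u).
  by rewrite ler_wpM2r // mulr_ge0 ?sqr_ge0.
have : 0 <= tau ^+ 2 * u by rewrite mulr_ge0 ?sqr_ge0.
by rewrite /s /m; lra.
Qed.

End ColouringTails.

(** * Distributing the edges among the bipartite graphs that contain them *)

Section Splitting.
Local Open Scope ring_scope.
Variables (E I : finType) (r K : nat) (e : 'I_r -> I -> I -> E) (H : {set E}).
Hypothesis K0 : (0 < K)%N.
Hypothesis e_inj : forall t j i j' i', e t j i = e t j' i' -> j = j' /\ i = i'.

Definition host t : {set I * I} := [set x | e t x.1 x.2 \in H].

Definition users x := [set t | [exists j, exists i, x == e t j i]].

Hypothesis cover : forall x, x \in H -> (#|users x| <= K)%N.

Variables (tau L u delta : R).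
Hypotheses (tau0 : 0 <= tau) (tau1 : tau <= 1 / 2) (L0 : 0 <= L) (u0 : 0 <= u).
Hypothesis hr : forall t a, L * K%:R <= (rdeg (host t) a)%:R.
Hypothesis hc : forall t b, L * K%:R <= (cdeg (host t) b)%:R.
Hypothesis hcodeg : forall t a a', a != a' -> (codeg (host t) a a')%:R <= u * K%:R ^+ 2.
Hypotheses (dL : exp (- (L * tau ^+ 2 / 8)) <= delta) (du : exp (- (u * tau ^+ 2 / 8)) <= delta).
Hypothesis rdelta : (r * (#|I| + #|I| + #|I| ^ 2))%:R * delta < 1.

(** The rank of [t] among the graphs using [x]. For [x] in [H] there are at most [K] users, so
    reduction modulo [K], which only makes the definition total, leaves the ranks distinct. *)
Definition slot t x : 'I_K := Ordinal (ltn_pmod (index t (enum (users x))) K0).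

Lemma slot_inj t t' x : x \in H -> t \in users x -> t' \in users x ->
  slot t x = slot t' x -> t = t'.
Proof.
move=> xH tx tx' /(congr1 val) /=.
have lt s : s \in users x -> (index s (enum (users x)) < K)%N.
  by move=> sx; apply: leq_trans (cover xH); rewrite cardE index_mem mem_enum.
rewrite !modn_small ?lt // => h.
by rewrite -(nth_index t (_ : t \in enum (users x))) ?mem_enum // h nth_index // mem_enum.
Qed.

Definition part (phi : {ffun E -> 'I_K}) t : {set I * I} :=
  [set x in host t | phi (e t x.1 x.2) == slot t (e t x.1 x.2)].

Lemma agree1 t phi x : agree (slot t) [set x] phi = (phi x == slot t x).
Proof.
apply/forall_inP/idP => [h|h y]; first by apply: h; rewrite inE.
by rewrite inE => /eqP ->.
Qed.

(** The graph [t] keeps the edge [x] when the colour of [x] is [slot t x], so no edge is kept by two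
    graphs. An edge survives with probability [1 / K], two distinct edges together with probability
    [1 / K ^ 2]. By [e_inj] the edges of a row or column, and the pairs of edges behind a codegree,
    are disjoint; the Chernoff bounds and a union bound over rows, columns and pairs of rows then
    give one good colouring. *)
Lemma split_hosts : exists G : 'I_r -> {set I * I},
  [/\ forall t, G t \subset host t,
      forall t t' x x', x \in G t -> x' \in G t' ->
        e t x.1 x.2 = e t' x'.1 x'.2 -> t = t',
      forall t a, (1 - tau) * L <= (rdeg (G t) a)%:R,
      forall t b, (1 - tau) * L <= (cdeg (G t) b)%:R &
      forall t a a', a != a' -> (codeg (G t) a a')%:R <= (1 + tau) * u].
Proof.
pose Sr t a := [set i | (a, i) \in host t].
pose Pr t a i := [set e t a i].
pose Sc t b := [set j | (j, b) \in host t].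
pose Pc t b j := [set e t j b].
pose Sd t (a : I * I) := [set i | ((a.1, i) \in host t) && ((a.2, i) \in host t)].
pose Pd t (a : I * I) i := [set e t a.1 i; e t a.2 i].
pose bad (z : 'I_r * (I + I + I * I)) : {set {ffun E -> 'I_K}} :=
  match z.2 with
  | inl (inl a) => [set phi | (hits (slot z.1) (Pr z.1 a) (Sr z.1 a) phi)%:R < (1 - tau) * L]
  | inl (inr b) => [set phi | (hits (slot z.1) (Pc z.1 b) (Sc z.1 b) phi)%:R < (1 - tau) * L]
  (* The codegree bound concerns distinct rows, so diagonal pairs get the empty event. *)
  | inr a => if a.1 == a.2 then set0 else
      [set phi | (1 + tau) * u < (hits (slot z.1) (Pd z.1 a) (Sd z.1 a) phi)%:R]
  end.
have cardS (Q : pred I) : #|[set i | Q i]| = (\sum_i Q i)%N.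
  by rewrite -sum1_card big_mkcond; apply: eq_bigr => i _; rewrite inE; case: (Q i).
have [phi hphi] : exists phi, forall z, phi \notin bad z.
  apply: (@exists_avoiding _ _ _ delta).
  - by rewrite card_ffun card_ord expn_gt0 K0.
  - move=> [t [[a|b]|[a a']]]; rewrite /bad /=.
    + apply: le_trans (ler_wpM2l _ dL) => //.
      apply: (@hits_lower _ _ _ _ _ _ 1) => //.
      * by move=> i _; rewrite cards1.
      * move=> i j _ _ ij; rewrite disjoints1 inE.
        by apply: contra ij => /eqP /e_inj[_ ->].
      * by rewrite expr1 cardS; exact: hr.
    + apply: le_trans (ler_wpM2l _ dL) => //.
      apply: (@hits_lower _ _ _ _ _ _ 1) => //.
      * by move=> i _; rewrite cards1.
      * move=> i j _ _ ij; rewrite disjoints1 inE.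
        by apply: contra ij => /eqP /e_inj[-> _].
      * by rewrite expr1 cardS; exact: hc.
    + have [_|aa'] := eqVneq a a'.
        by rewrite cards0 mulr_ge0 // (le_trans _ dL) // ltW // exp_gt0.
      apply: le_trans (ler_wpM2l _ du) => //.
      apply: (@hits_upper _ _ _ _ _ _ 2) => //.
      * move=> i _; rewrite cards2; case: eqP => // /e_inj[/eqP].
        by rewrite (negPf aa').
      * move=> i j _ _ ij; rewrite -setI_eq0; apply/eqP/setP => x; rewrite !inE.
        apply/negbTE; rewrite negb_and -implybE; apply/implyP.
        by case/orP => /eqP ->; rewrite negb_or; apply/andP; split;
          apply: contra ij => /eqP /e_inj[_ ->].
      * exact: hcodeg.
  - by rewrite card_prod !card_sum card_prod card_ord mulnn.
exists (part phi); split.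
- by move=> t; apply/subsetP => x; rewrite inE => /andP[].
- move=> t t' [j i] [j' i']; rewrite !inE /= => /andP[xH /eqP p1] /andP[_ /eqP p2] ee.
  apply: (@slot_inj _ _ (e t j i)) => //.
  + by rewrite inE; apply/existsP; exists j; apply/existsP; exists i.
  + by rewrite inE ee; apply/existsP; exists j'; apply/existsP; exists i'.
  + by rewrite -p1 [in RHS]ee -p2 ee.
- move=> t a; have := hphi (t, inl (inl a)); rewrite !inE /= -leNgt /hits.
  move/le_trans; apply; rewrite ler_nat /rdeg cardS.
  by apply: leq_sum => i _; rewrite !inE agree1.
- move=> t b; have := hphi (t, inl (inr b)); rewrite !inE /= -leNgt /hits.
  move/le_trans; apply; rewrite ler_nat /cdeg cardS.
  by apply: leq_sum => i _; rewrite !inE agree1.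
move=> t a a' aa'; have := hphi (t, inr (a, a')); rewrite /bad /= (negPf aa').
rewrite inE -leNgt; apply: le_trans; rewrite ler_nat /hits /codeg.
apply: subset_leq_card; apply/subsetP => i; rewrite !inE /=.
move=> /andP[/andP[-> h1] /andP[-> h2]] /=.
by apply/forall_inP => x; rewrite !inE => /orP[/eqP ->|/eqP ->].
Qed.

End Splitting.
(** * Concentration for random permutations *)

Section Shuffle.
Local Open Scope ring_scope.
Variable T : finType.
Implicit Types (s : seq T) (f : {perm T} -> R) (pi rho : {perm T}).

(* Fisher-Yates: the conditional expectations of the exposure martingale, computed by
   averaging over the element [u] swapped with each entry of [s] in turn. *)
Fixpoint shuffle s f pi : R :=
  if s is a :: s' then
    (\sum_(u <- s) shuffle s' f (tperm a u * pi)%g) / (size s)%:R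
  else f pi.

(** One step of Fisher-Yates: composing with [tperm a u] brings the image of [a] back to [a], and
    what remains moves only entries of [s]. *)
Lemma perm_on_cons a s u rho : u \in a :: s -> a \notin s ->
  perm_on [set x in a :: s] rho && (rho a == u) =
  perm_on [set x in s] (rho * tperm a u)%g.
Proof.
move=> us aNs; apply/idP/idP => [/andP[on /eqP ra]|on].
  apply/subsetP => x; rewrite !inE permM => xm.
  have [xa|xa] := eqVneq x a; first by rewrite xa ra tpermR eqxx in xm.
  have xs : rho x = x -> x \in s.
    move=> rx; move: xm; rewrite rx; case: tpermP; last by rewrite eqxx.
      by move=> /eqP; rewrite (negPf xa).
    by move=> xu _; case/eqP: xa; apply: (@perm_inj _ rho); rewrite ra rx.
  have [/xs //|rx] := eqVneq (rho x) x.
  by have := subsetP on x; rewrite !inE => /(_ rx); rewrite (negPf xa).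
have ra : rho a = u.
  have : (rho * tperm a u)%g a = a by rewrite (out_perm on) // inE.
  by rewrite permM => /(congr1 (tperm a u)); rewrite tpermK tpermL.
rewrite ra eqxx andbT; apply/subsetP => x; rewrite !inE => rx.
have [//|xa] := eqVneq x a; rewrite /=; apply: contraT => xs.
have : (rho * tperm a u)%g x = x by rewrite (out_perm on) // inE.
rewrite permM => /(congr1 (tperm a u)); rewrite tpermK; case: tpermP => [/eqP|xu|_ _ /eqP].
- by rewrite (negPf xa).
- move=> rxa; move: us; rewrite in_cons -xu (negPf xa) (negPf xs) //.
- by rewrite (negPf rx).
Qed.

Lemma sum_perm_on_cons a s (F : {perm T} -> R) : uniq (a :: s) ->
  \sum_(rho | perm_on [set x in a :: s] rho) F rho =
  \sum_(u <- a :: s) \sum_(rho | perm_on [set x in s] rho) F (rho * tperm a u)%g.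
Proof.
move=> us; rewrite big_uniq //=.
rewrite (partition_big (fun rho : {perm T} => rho a) (mem (a :: s))) /=; last first.
  move=> rho on; have := perm_closed a on; rewrite !in_set mem_head => ->.
  by [].
apply: eq_bigr => u uas; rewrite (reindex_inj (mulIg (tperm a u))) /=.
apply: eq_bigl => rho; rewrite perm_on_cons //; last by case/andP: us.
by rewrite -mulgA tperm2 mulg1.
Qed.

(** Identifies [shuffle s f pi] as the average of [f] over the coset of the permutations supported
    on [s]; the full enumeration then gives the mean. *)
Lemma shuffle_sum s f pi : uniq s ->
  shuffle s f pi * (size s)`!%:R = \sum_(rho | perm_on [set x in s] rho) f (rho * pi)%g.
Proof.
elim: s pi => [|a s IH] pi us.
  rewrite /= mulr1 (bigD1 (1%g : {perm T})) /=; last by apply/subsetP => x; rewrite !inE perm1 eqxx.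
  rewrite mul1g big1 ?addr0 // => rho /andP[on]; case/eqP; apply/permP => x.
  by rewrite perm1 (out_perm on) // !inE.
rewrite sum_perm_on_cons // [shuffle _ _ _]/= factS natrM mulrA divfK ?pnatr_eq0 //.
rewrite mulr_suml; apply: eq_bigr => u _; rewrite IH; last by case/andP: us.
by apply: eq_bigr => rho _; rewrite mulgA.
Qed.

Definition mean f := (\sum_pi f pi) / #|{perm T}|%:R.

Lemma shuffle_mean f pi : shuffle (enum T) f pi = mean f.
Proof.
have c : #|{perm T}| = (size (enum T))`!.
  rewrite -cardE -[in RHS]cardsT -(@card_perm _ setT); apply: eq_card => rho.
  by rewrite inE; symmetry; apply/subsetP => x _; rewrite inE.
apply: (canRL (mulfK _)); first by rewrite pnatr_eq0 c -lt0n fact_gt0.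
rewrite c shuffle_sum ?enum_uniq // [RHS](reindex_inj (mulIg pi)).
apply: eq_bigl => rho; apply/subsetP => x _; by rewrite inE mem_enum.
Qed.

Definition lipschitz (c : R) f :=
  forall a b pi, `|f (tperm a b * pi)%g - f pi| <= c.

(** A transposition conjugated by [tperm a u] is again a transposition, so the two averages can be
    compared term by term. Requiring the Lipschitz condition for all transpositions is what makes it
    stable. *)
Lemma shuffle_lipschitz c s f : lipschitz c f -> lipschitz c (shuffle s f).
Proof.
move=> lf; elim: s => // a s IH x y pi /=.
rewrite -mulrBl -sumrB normrM normfV [`|_%:R|]ger0_norm //.
rewrite ler_pdivrMr ?ltr0n //; apply: le_trans (ler_norm_sum _ _ _) _.
have -> : c * (size s).+1%:R = \sum_(u <- a :: s) c.
  by rewrite big_const_seq count_predT iter_addr_0 mulr_natr.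
apply: ler_sum => u _.
have -> : (tperm a u * (tperm x y * pi) =
   tperm (tperm a u x) (tperm a u y) * (tperm a u * pi))%g.
  rewrite -tpermJ conjgE tpermV !mulgA.
  by rewrite -[in RHS](mulgA _ (tperm a u) (tperm a u)) tperm2 mulg1.
exact: IH.
Qed.

(** Values within [c] of a common one are within [2 * c] of their average. In the quadratic bound
    for the exponential the linear term averages out, leaving [(2 * c) ^ 2]; the range [c <= 1 / 6]
    keeps [2 * c] below [1 / 3]. *)
Lemma exp_average (h : T -> R) s (c : R) (u0 : T) : s != [::] -> 0 <= c -> c <= 1 / 6 ->
  (forall u, `|h u - h u0| <= c) ->
  (\sum_(u <- s) exp (h u)) / (size s)%:R <=
    exp ((\sum_(u <- s) h u) / (size s)%:R + 4 * c ^+ 2).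
Proof.
move=> s0 c0 c6 hc; have sz : 0 < (size s)%:R :> R.
  by rewrite ltr0n lt0n size_eq0.
set m := (_ / _ in X in _ <= exp X).
have sum_const (x : R) : \sum_(u <- s) x = (size s)%:R * x.
  by rewrite big_const_seq count_predT iter_addr_0 mulr_natl.
have hm u : `|h u - m| <= 2 * c.
  have -> : h u - m = (\sum_(v <- s) (h u - h v)) / (size s)%:R.
    by rewrite sumrB sum_const mulrBl mulrAC divff ?mul1r // gt_eqF.
  rewrite normrM normfV [`|_%:R|]ger0_norm // ler_pdivrMr //.
  apply: le_trans (ler_norm_sum _ _ _) _; rewrite mulrC -sum_const.
  apply: ler_sum => v _; have := hc u; have := hc v.
  by rewrite !ler_norml; lra.
have bound u : exp (h u) <= exp m * (1 + (h u - m) + 4 * c ^+ 2).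
  have -> : exp (h u) = exp m * exp (h u - m) by rewrite -expD addrC subrK.
  rewrite ler_pM2l ?exp_gt0 //.
  have := hm u; rewrite ler_norml => /andP[h1 h2].
  apply: le_trans (exp_le_quadratic _) _; first by lra.
  rewrite lerD2l; have -> : 4 * c ^+ 2 = (2 * c) ^+ 2 by ring.
  by rewrite -(real_normK (num_real (h u - m))) ler_pXn2r ?nnegrE //; lra.
rewrite ler_pdivrMr //; apply: (@le_trans _ _ (\sum_(u <- s) exp m * (1 + (h u - m) + 4 * c ^+ 2))).
  exact: ler_sum.
rewrite -mulr_sumr expD -mulrA ler_pM2l ?exp_gt0 //.
rewrite !big_split /= sumrN !sum_const.
have -> : \sum_(u <- s) h u = (size s)%:R * m by rewrite /m mulrC divfK // gt_eqF.
rewrite subrr addr0 -mulrDr [leRHS]mulrC ler_pM2l //; exact: exp_ge1Dx.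
Qed.

(** The Azuma induction, each exposed element costing a factor [exp (4 * c ^ 2)]. The reference
    value for the increments is the swap of [a] with itself, which is the identity. *)
Lemma shuffle_mgf c s f pi : lipschitz c f -> 0 <= c -> c <= 1 / 6 ->
  shuffle s (fun x => exp (f x)) pi <= exp (shuffle s f pi + (size s)%:R * (4 * c ^+ 2)).
Proof.
move=> lf c0 c6; elim: s pi => [|a s IH] pi; first by rewrite /= mul0r addr0.
rewrite [leLHS]/=; apply: (@le_trans _ _
  ((\sum_(u <- a :: s) exp (shuffle s f (tperm a u * pi)%g)) / (size s).+1%:R *
     exp ((size s)%:R * (4 * c ^+ 2)))).
  rewrite mulrAC ler_wpM2r ?invr_ge0 // mulr_suml; apply: ler_sum => u _.
  by rewrite -expD; exact: IH.
have -> : shuffle (a :: s) f pi + (size (a :: s))%:R * (4 * c ^+ 2) =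
  (shuffle (a :: s) f pi + 4 * c ^+ 2) + (size s)%:R * (4 * c ^+ 2).
  by rewrite [size _]/= -addn1 natrD; ring.
rewrite [in leRHS]expD ler_pM2r ?exp_gt0 //.
apply: (exp_average (u0 := a)) => // u.
by rewrite tperm1 mul1g; exact: shuffle_lipschitz.
Qed.

Lemma perm_tail c f (t : R) : lipschitz c f -> 0 < c -> 0 <= t ->
  t <= c * #|T|%:R ->
  #|[set pi | mean f + t < f pi]|%:R <=
    #|{perm T}|%:R * exp (- (t ^+ 2 / (16 * c ^+ 2 * #|T|%:R))).
Proof.
move=> lf c0 t0 tc; have [T0|T0] := posnP #|T|.
  rewrite T0 mulr0 invr0 mulr0 oppr0 exp0 mulr1 ler_nat; exact: max_card.
have n0 : 0 < #|T|%:R :> R by rewrite ltr0n.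
(* This minimises [- l * t + 4 * c ^ 2 * l ^ 2 * #|T|], with value [- l * t / 2]; the hypothesis
   [t <= c * #|T|] keeps [l * c] below [1 / 6]. *)
pose l := t / (8 * c ^+ 2 * #|T|%:R).
have D0 : 0 < 8 * c ^+ 2 * #|T|%:R by rewrite !mulr_gt0 // exprn_gt0.
have l0 : 0 <= l by rewrite divr_ge0 // ltW.
have ll : lipschitz (l * c) (fun x => l * f x).
  by move=> a b pi; rewrite -mulrBr normrM (ger0_norm l0) ler_wpM2l.
have lc : l * c <= 1 / 6.
  rewrite /l mulrAC ler_pdivrMr //.
  have : t * c <= c * #|T|%:R * c by rewrite ler_pM2r.
  have : 0 < c ^+ 2 * #|T|%:R by rewrite mulr_gt0 // exprn_gt0.
  by lra.
have lc0 : 0 <= l * c by rewrite mulr_ge0 // ltW.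
have := shuffle_mgf (enum T) 1%g ll lc0 lc.
rewrite !shuffle_mean -cardE => h.
have P0 : 0 < #|{perm T}|%:R :> R.
  by rewrite ltr0n; apply/card_gt0P; exists 1%g.
have ml : mean (fun x => l * f x) = l * mean f by rewrite /mean -mulr_sumr mulrA.
have := @markov_card _ (fun pi => exp (l * f pi)) [set pi | mean f + t < f pi]
  (exp (l * (mean f + t))).
move=> /(_ _ _) mk.
rewrite -(ler_pM2r (exp_gt0 (l * (mean f + t)))); apply: le_trans (mk _ _) _.
- by move=> pi; rewrite ltW // exp_gt0.
- by move=> pi; rewrite inE => /ltW lt; apply: ler_exp; rewrite ler_wpM2l.
rewrite -[leRHS]mulrA [leRHS]mulrC -ler_pdivrMr //; apply: le_trans h _.
rewrite -expD ml; apply: ler_exp.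
have -> : t ^+ 2 / (16 * c ^+ 2 * #|T|%:R) = l * t / 2.
  by rewrite /l; field; rewrite !gt_eqF.
have -> : #|T|%:R * (4 * (l * c) ^+ 2) = l * t / 2.
  by rewrite /l; field; rewrite !gt_eqF.
by lra.
Qed.

Lemma perm_tail_lower c f (t : R) : lipschitz c f -> 0 < c -> 0 <= t ->
  t <= c * #|T|%:R ->
  #|[set pi | f pi < mean f - t]|%:R <=
    #|{perm T}|%:R * exp (- (t ^+ 2 / (16 * c ^+ 2 * #|T|%:R))).
Proof.
move=> lf c0 t0 tc.
have lf' : lipschitz c (fun x => - f x).
  by move=> a b pi; rewrite -opprD normrN.
apply: le_trans (perm_tail lf' c0 t0 tc); rewrite ler_nat; apply: subset_leq_card.
apply/subsetP => pi; rewrite !inE.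
have -> : mean (fun x => - f x) = - mean f by rewrite /mean sumrN mulNr.
by lra.
Qed.

End Shuffle.

(** * Images of fixed blocks under a random permutation *)

Section RandomBlocks.
Variable T : finType.
Implicit Types (P Q : {set T}) (F : {set {set T}}) (pi rho : {perm T}).

Lemma imset_permM pi rho Q : (pi * rho)%g @: Q = rho @: (pi @: Q).
Proof. by rewrite -imset_comp; apply: eq_imset => x; rewrite /= permM. Qed.

Lemma imset_tperm a b Q : a \in Q -> b \notin Q -> tperm a b @: Q = b |: (Q :\ a).
Proof.
move=> aQ bQ; have ab : a != b by apply: contraNneq bQ => <-.
apply/setP => x; rewrite -{1}(tpermK a b x) mem_imset; last exact: perm_inj.
rewrite !inE; case: tpermP => [->|->|/eqP xa /eqP xb].
- by rewrite eqxx (negPf bQ) (negPf ab).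
- by rewrite eqxx aQ.
- by rewrite (negPf xb) xa.
Qed.

Lemma imset_tperm_id a b Q : a \notin Q -> b \notin Q -> tperm a b @: Q = Q.
Proof.
move=> aQ bQ; rewrite -[RHS]imset_id; apply: eq_in_imset => x xQ.
by case: tpermP => // xx; move: xQ; rewrite xx ?(negPf aQ) ?(negPf bQ).
Qed.

Lemma exists_perm_imset Q Q' : #|Q| = #|Q'| -> exists rho : {perm T}, rho @: Q = Q'.
Proof.
elim: {Q}_.+1 {-2}Q (ltnSn #|Q :\: Q'|) => // m IH Q le cQ.
have cD : #|Q :\: Q'| = #|Q' :\: Q|.
  by apply/eqP; rewrite -(eqn_add2l #|Q :&: Q'|) cardsID setIC cardsID cQ.
have [Q0|[a aQ]] := set_0Vmem (Q :\: Q').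
  exists 1%g; have -> : (1%g : {perm T}) @: Q = Q.
    by rewrite -[RHS]imset_id; apply: eq_imset => x; rewrite perm1.
  by apply/eqP; rewrite eqEcard -cQ leqnn andbT -setD_eq0 Q0.
have [Q0|[b bQ]] := set_0Vmem (Q' :\: Q).
  by move: cD; rewrite Q0 cards0 => /eqP; rewrite cards_eq0 => /eqP Q1; rewrite Q1 inE in aQ.
move: aQ bQ; rewrite !inE => /andP[aQ' aQ] /andP[bQ bQ'].
have [||rho h] := IH (tperm a b @: Q).
- rewrite imset_tperm //; suff : (b |: Q :\ a) :\: Q' \proper Q :\: Q'.
    by move=> /proper_card lt; exact: leq_trans lt le.
  apply/properP; split; last first.
    exists a; rewrite !inE ?aQ ?aQ' //= eqxx /= orbF.
    by apply: contraNneq bQ => <-.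
  apply/subsetP => x; rewrite !inE => /andP[xQ']; rewrite xQ' /=.
  by case/orP => [/eqP xb|/andP[]//]; rewrite xb bQ' in xQ'.
- by rewrite card_imset //; exact: perm_inj.
by exists (tperm a b * rho)%g; rewrite imset_permM.
Qed.

(** The image of [P] is uniform over the sets of its size: right multiplication by a permutation
    carrying [P] to [Q] maps the permutations fixing [P] setwise onto those sending [P] to [Q]. *)
Lemma card_imset_in s P F : #|P| = s -> (forall Q, Q \in F -> #|Q| = s) ->
  #|[set pi : {perm T} | pi @: P \in F]| * 'C(#|T|, s) = #|{perm T}| * #|F|.
Proof.
move=> cP cF.
pose N Q := #|[set pi : {perm T} | pi @: P == Q]|.
have N1 Q : #|Q| = s -> N Q = N P.
  move=> cQ; have [|rho h] := @exists_perm_imset P Q; first by rewrite cP.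
  rewrite /N -[RHS](card_imset _ (mulIg rho)); apply: eq_card => pi.
  rewrite inE; apply/eqP/imsetP => [hQ|[pi']].
    exists (pi * rho^-1)%g; last by rewrite -mulgA mulVg mulg1.
    rewrite inE imset_permM hQ -h -imset_permM mulgV.
    by rewrite -[X in _ == X]imset_id; apply/eqP; apply: eq_imset => x; rewrite perm1.
  by rewrite inE => /eqP hP ->; rewrite imset_permM hP.
have sumN (G : {set {set T}}) :
    #|[set pi : {perm T} | pi @: P \in G]| = \sum_(Q in G) N Q.
  rewrite -sum1_card (partition_big (fun pi : {perm T} => pi @: P) (mem G)) /=; last first.
    by move=> pi; rewrite inE.
  apply: eq_bigr => Q QG; rewrite /N -sum1_card; apply: eq_bigl => pi.
  by rewrite !inE; case: eqP => [->|]; rewrite ?andbF ?QG.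
have tot : #|{perm T}| = 'C(#|T|, s) * N P.
  have -> : #|{perm T}| = #|[set pi : {perm T} | pi @: P \in [set Q : {set T} | #|Q| == s]]|.
    rewrite -cardsT; apply: eq_card => pi; rewrite !inE card_imset ?cP ?eqxx //.
    exact: perm_inj.
  rewrite sumN (eq_bigr (fun=> N P)); last by move=> Q; rewrite inE => /eqP; exact: N1.
  by rewrite sum_nat_const card_draws.
rewrite sumN (eq_bigr (fun=> N P)); last by move=> Q /cF; exact: N1.
by rewrite sum_nat_const tot mulnC mulnCA mulnC.
Qed.

Local Open Scope ring_scope.
Variables (I : finType) (Q : I -> {set T}) (s : nat).
Hypothesis cardQ : forall i, #|Q i| = s.
Hypothesis multQ : forall x, (#|[set i | x \in Q i]| <= 2)%N.
Variable F : {set {set T}}.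
Hypothesis cardF : forall X, X \in F -> #|X| = s.
Hypothesis sT : (s <= #|T|)%N.

Definition blocks_in pi := #|[set i | pi @: Q i \in F]|.

(* A transposition moves two elements, each of them in at most two blocks. *)
Lemma blocks_in_lipschitz : lipschitz 4 (fun pi => (blocks_in pi)%:R : R).
Proof.
have half a b pi : (blocks_in (tperm a b * pi)%g <= blocks_in pi + 4)%N.
  pose A := [set i | a \in Q i] :|: [set i | b \in Q i].
  have : (#|A| <= 2 + 2)%N.
    by apply: leq_trans (leq_card_setU _ _) _; rewrite leq_add.
  move=> cA; rewrite addnC; apply: leq_trans (leq_add cA (leqnn _)).
  apply: leq_trans (leq_card_setU _ _); apply: subset_leq_card.
  apply/subsetP => i; rewrite !inE imset_permM.
  have [|aQ] := boolP (a \in Q i) => //=; have [|bQ] := boolP (b \in Q i) => //=.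
  by rewrite imset_tperm_id.
move=> a b pi; have h1 := half a b pi.
have := half a b (tperm a b * pi)%g; rewrite mulgA tperm2 mul1g => h2.
move: h1 h2; rewrite -!(ler_nat R) !natrD => h1 h2.
by rewrite ler_norml; lra.
Qed.

Lemma blocks_in_mean :
  mean (fun pi => (blocks_in pi)%:R : R) = #|I|%:R * #|F|%:R / 'C(#|T|, s)%:R.
Proof.
have P0 : #|{perm T}|%:R != 0 :> R.
  by rewrite pnatr_eq0 -lt0n; apply/card_gt0P; exists 1%g.
have C0 : 'C(#|T|, s)%:R != 0 :> R by rewrite pnatr_eq0 -lt0n bin_gt0.
have e : (\sum_(pi : {perm T}) blocks_in pi * 'C(#|T|, s) = #|I| * (#|{perm T}| * #|F|))%N.
  rewrite -big_distrl /=.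
  transitivity (\sum_i #|[set pi : {perm T} | pi @: Q i \in F]| * 'C(#|T|, s))%N.
    rewrite -big_distrl /=; congr (_ * _)%N.
    under eq_bigr do rewrite /blocks_in -sum1_card big_mkcond.
    under [RHS]eq_bigr do rewrite -sum1_card big_mkcond.
    rewrite exchange_big; apply: eq_bigr => i _; apply: eq_bigr => pi _.
    by rewrite !inE.
  rewrite (eq_bigr (fun=> (#|{perm T}| * #|F|)%N)) ?sum_nat_const // => i _.
  exact: card_imset_in.
apply: (mulIf P0); apply: (mulIf C0); rewrite /mean divfK // mulrAC divfK //.
by rewrite -natr_sum -!natrM big_distrl /= e mulnA mulnAC.
Qed.

End RandomBlocks.

(** * Choosing permutations that cover the edges evenly *)

Section GreedyCover.
Local Open Scope ring_scope.
Variables (W E : finType) (good : {set W}) (cov : W -> {set E}) (H : {set E}) (q eps : R).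
Hypotheses (eps0 : 0 <= eps) (q0 : 0 <= q) (good0 : (0 < #|good|)%N).
Hypothesis hq : forall x, x \in H ->
  #|[set w in good | x \in cov w]|%:R <= q * #|good|%:R.

(* The potential [\sum_x (1 + eps) ^+ multiplicity x] grows by a factor at most
   [1 + eps * q] for the average choice of a further [w]. *)
Lemma greedy_cover r : exists s : seq W, [/\ size s = r, {subset s <= good} &
  \sum_(x in H) (1 + eps) ^+ count (fun w => x \in cov w) s <=
    #|H|%:R * (1 + eps * q) ^+ r].
Proof.
elim: r => [|r [s [ss sg IH]]].
  by exists [::]; split=> //=; rewrite sumr_const mulr1.
pose Phi w := \sum_(x in H) (1 + eps) ^+ count (fun w => x \in cov w) (w :: s).
have avg : \sum_(w in good) Phi w <= \sum_(w in good) (#|H|%:R * (1 + eps * q) ^+ r.+1).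
  have c0 : 0 <= (1 + eps * q) * #|good|%:R by rewrite mulr_ge0 // addr_ge0 // mulr_ge0.
  have -> : \sum_(w in good) (#|H|%:R * (1 + eps * q) ^+ r.+1) =
      #|H|%:R * (1 + eps * q) ^+ r * ((1 + eps * q) * #|good|%:R).
    by rewrite big_const iter_addr_0 -(mulr_natr (_ * _)) exprS; ring.
  apply: le_trans (ler_wpM2r c0 IH).
  rewrite /Phi exchange_big mulr_suml; apply: ler_sum => x xH /=.
  under eq_bigr do rewrite exprD.
  rewrite -mulr_suml mulrC ler_wpM2l ?exprn_ge0 ?addr_ge0 //.
  have -> : \sum_(w in good) (1 + eps) ^+ (x \in cov w) =
     \sum_(w in good) (1 + eps * (x \in cov w)%:R).
    by apply: eq_bigr => w _; case: (x \in _); rewrite ?mulr1 ?mulr0 ?addr0.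
  rewrite big_split sumr_const /= mulrDl mul1r lerD2l -mulr_sumr -mulrA ler_wpM2l //.
  apply: le_trans (hq xH); rewrite -natr_sum ler_nat -sum1_card.
  rewrite [X in (_ <= X)%N]big_mkcond [X in (X <= _)%N]big_mkcond /=.
  by apply: leq_sum => w _; rewrite !inE; case: (w \in good); case: (x \in _).
have [w wg le] : exists2 w, w \in good & Phi w <= #|H|%:R * (1 + eps * q) ^+ r.+1.
  apply/exists_inP; apply: contraT => /exists_inPn h; move: avg.
  have /card_gt0P[w0 w0g] := good0.
  rewrite leNgt => /negP[]; rewrite (bigD1 w0) //= [ltRHS](bigD1 w0) //=.
  apply: ltr_leD; first by rewrite ltNge h.
  by apply: ler_sum => w /andP[/h]; rewrite -ltNge => /ltW.
exists (w :: s); split=> //=; first by rewrite ss.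
by move=> x; rewrite in_cons => /orP[/eqP ->|/sg].
Qed.
End GreedyCover.

(** * Hamilton cycles from perfect matchings *)

Section Positions.
Variables (n l a : nat).
Let nu := n %/ l.
Hypotheses (ln : l %| n) (nu3 : 2 < nu) (a0 : 0 < a) (al : a < l).
Implicit Types (x : 'I_n) (pi : {perm 'I_n}).

Let l0 : 0 < l. Proof. exact: leq_ltn_trans al. Qed.
Let nE : n = nu * l. Proof. by rewrite divnK. Qed.
Let nu0 : 0 < nu. Proof. exact: ltn_trans nu3. Qed.

(* Positions [i * l + c] carry [A_i] for [c < a] and [B_i] for [a <= c < l]. *)
Definition linkpos (i : nat) : {set 'I_n} := [set x : 'I_n | (x %/ l == i) && (x %% l < a)].
Definition freepos (j : nat) : {set 'I_n} := [set x : 'I_n | (x %/ l == j) && (a <= x %% l)].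
Definition linkspos (i : nat) : {set 'I_n} := linkpos i :|: linkpos (i.+1 %% nu).

Lemma pos_lt i c : i < nu -> c < l -> i * l + c < n.
Proof.
move=> iu cl; rewrite nE -ltn_subRL -mulnBl; apply: leq_trans cl _.
by rewrite leq_pmull // subn_gt0.
Qed.

Lemma blk_lt x : x %/ l < nu.
Proof. by rewrite ltn_divLR // -nE. Qed.

Lemma pos_div i c : c < l -> (i * l + c) %/ l = i.
Proof.
by move=> cl; rewrite divnMDl ?(leq_ltn_trans _ cl) // divn_small // addn0.
Qed.

Lemma pos_mod i c : c < l -> (i * l + c) %% l = c.
Proof. by move=> cl; rewrite modnMDl modn_small. Qed.

Lemma card_blk (i d e : nat) : i < nu -> d + e <= l ->
  #|[set x : 'I_n | (x %/ l == i) && (d <= x %% l < d + e)]| = e.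
Proof.
move=> iu del; have lt (c : 'I_e) : i * l + (d + c) < n.
  by apply: pos_lt => //; apply: leq_trans del; rewrite ltn_add2l.
pose f c := Ordinal (lt c).
have fi : injective f.
  by move=> c c' /(congr1 val) /= /addnI/addnI/val_inj.
rewrite -[RHS]card_ord -(card_imset _ fi); apply: eq_card => x.
rewrite inE; apply/andP/imsetP => [[/eqP xi /andP[dx xde]]|[c _ ->]].
  have ce : x %% l - d < e by rewrite ltn_subLR.
  exists (Ordinal ce) => //; apply: val_inj => /=.
  by rewrite subnKC // [LHS](divn_eq x l) xi.
have cl : d + c < l by apply: leq_trans del; rewrite ltn_add2l.
by rewrite /= pos_div // pos_mod // eqxx leq_addr ltn_add2l ltn_ord.
Qed.

Lemma card_linkpos i : i < nu -> #|linkpos i| = a.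
Proof.
move=> iu; rewrite -[RHS](@card_blk i 0 a iu (ltnW al)); apply: eq_card => x.
by rewrite !inE.
Qed.

Lemma card_freepos j : j < nu -> #|freepos j| = l - a.
Proof.
move=> ju; rewrite -[RHS](@card_blk j a (l - a) ju) ?subnKC ?(ltnW al) //.
by apply: eq_card => x; rewrite !inE ltn_pmod // andbT.
Qed.

Lemma disjoint_linkpos i i' : i != i' -> [disjoint linkpos i & linkpos i'].
Proof.
move=> ii; rewrite -setI_eq0; apply/eqP/setP => x; rewrite !inE.
by case: eqP => [->|] //=; rewrite (negPf ii) andbF.
Qed.

Lemma disjoint_linkpos_freepos i j : [disjoint linkpos i & freepos j].
Proof.
rewrite -setI_eq0; apply/eqP/setP => x; rewrite !inE ltnNge.
by case: (a <= _); rewrite !(andbF, andFb).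
Qed.

Lemma succ_lt i : i.+1 %% nu < nu. Proof. exact: ltn_pmod. Qed.

Lemma succ_neq i : i < nu -> i != i.+1 %% nu.
Proof.
move=> iu; have := iu; rewrite leq_eqVlt => /orP[/eqP e|lt].
  by rewrite e modnn; apply: contraTneq nu3 => i0; rewrite -e i0.
by rewrite modn_small // neq_ltn ltnSn.
Qed.

Lemma card_linkspos i : i < nu -> #|linkspos i| = 2 * a.
Proof.
move=> iu; rewrite cardsU !card_linkpos ?succ_lt // mul2n -addnn.
have := disjoint_linkpos (succ_neq iu); rewrite -setI_eq0 => /eqP ->.
by rewrite cards0 subn0.
Qed.

(** The bound 2 is the form [blocks_in_lipschitz] asks for, shared with the overlapping link
    pairs. *)
Lemma mult_freepos x : #|[set j : 'I_nu | x \in freepos j]| <= 2.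
Proof.
apply: (@leq_trans #|[set Ordinal (blk_lt x)]|); last by rewrite cards1.
apply: subset_leq_card; apply/subsetP => j; rewrite !inE => /andP[/eqP e _].
by apply/eqP/val_inj.
Qed.

Lemma pred_succ i : i < nu -> (i.+1 %% nu + nu).-1 %% nu = i.
Proof.
move=> iu; have := iu; rewrite leq_eqVlt => /orP[/eqP e|lt].
  by rewrite e modnn add0n -e /= modn_small.
by rewrite (modn_small lt) addSn /= modnDr modn_small.
Qed.

Lemma mult_linkspos x : #|[set i : 'I_nu | x \in linkspos i]| <= 2.
Proof.
pose i1 := Ordinal (blk_lt x).
have lt2 : (i1 + nu).-1 %% nu < nu by rewrite ltn_pmod.
apply: (@leq_trans #|[set i1; Ordinal lt2]|); last by rewrite cards2; case: eqP.
apply: subset_leq_card; apply/subsetP => i; rewrite !inE.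
case/orP => /andP[/eqP e _]; apply/orP; [left|right]; apply/eqP/val_inj => //=.
by rewrite e pred_succ.
Qed.

(** Single positions serve as tests: one free position of block [j] identifies [j], and the first
    position of block [i] shows that [i] is [i'] or its successor, and symmetrically. For [nu > 2]
    the two cannot be successors of each other. *)
Lemma linkspos_freepos_inj (i j i' j' : 'I_nu) :
  linkspos i :|: freepos j = linkspos i' :|: freepos j' -> j = j' /\ i = i'.
Proof.
move=> /setP e.
have hj (u v w z : 'I_nu) : linkspos u :|: freepos v =i linkspos w :|: freepos z -> v = z.
  move=> h; have := h (Ordinal (pos_lt (ltn_ord v) al)).
  rewrite !inE /= pos_div // pos_mod // eqxx leqnn ltnn !andbF /= andbT => /esym/eqP vz.
  exact: val_inj.
have hi (u v w z : 'I_nu) : linkspos u :|: freepos v =i linkspos w :|: freepos z ->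
    (u == w) || (u == w.+1 %% nu :> nat).
  move=> h; have := h (Ordinal (pos_lt (ltn_ord u) l0)).
  by rewrite !inE /= pos_div // pos_mod // eqxx a0 leqNgt a0 !andbF !andbT !orbF /= => <-.
split; first exact: hj e.
have /orP[/eqP //|/eqP h1] := hi _ _ _ _ e.
have /orP[/eqP //|/eqP h2] := hi _ _ _ _ (fsym e).
exfalso; move: h1 h2 (ltn_ord i) (ltn_ord i') nu3; move: (i : nat) (i' : nat) => u v.
have small w : w < nu -> w.+1 %% nu = if w.+1 == nu then 0 else w.+1.
  by rewrite leq_eqVlt => /orP[/eqP ->|lt]; rewrite ?modnn ?eqxx // modn_small // ltn_eqF.
move=> h1 h2 uu vu; rewrite (small v vu) in h1; rewrite (small u uu) in h2.
by move: h1 h2; do 2!case: eqP; lia.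
Qed.

End Positions.

(** * The cyclic order defined by a perfect matching *)

Section HamCycle.
Variables (n l a : nat).
Let nu := n %/ l.
Hypotheses (ln : l %| n) (nu3 : 2 < nu) (a0 : 0 < a) (al : a < l).

Let l0 : 0 < l. Proof. exact: leq_ltn_trans al. Qed.
Let nE : n = nu * l. Proof. by rewrite divnK. Qed.
Let nu0 : 0 < nu. Proof. exact: ltn_trans nu3. Qed.

(** The window of length [l + a] starting at block [i] consists of that whole block and the link
    part of the next one. The two cases separate the blocks reached before and after wrapping
    around. *)
Lemma window_mod i b c : i < nu -> b < nu -> c < l ->
  ((b * l + c + n - i * l) %% n < l + a) = (b == i) || (c < a) && (b == i.+1 %% nu).
Proof.
move=> iu bu cl.
have small b' : b' < nu -> b' * l + c < n by move=> h; exact: (pos_lt ln h cl).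
have val b' : b' < nu -> ((b' * l + c) %% n < l + a) = (b' == 0) || (c < a) && (b' == 1).
  move=> h; rewrite (modn_small (small _ h)); case: b' {h} => [|[|b']] //=.
  - by rewrite mul0n ltn_addr.
  - by rewrite mul1n ltn_add2l andbT.
  - by rewrite andbF !mulSn -!addnA ltn_add2l ltnNge (leq_trans (ltnW al)) ?leq_addr.
have succE : i.+1 %% nu = if i.+1 == nu then 0 else i.+1.
  by have := iu; rewrite leq_eqVlt => /orP[/eqP ->|lt];
    rewrite ?modnn ?eqxx // modn_small // ltn_eqF.
have [ib|bi] := leqP i b.
  have -> : b * l + c + n - i * l = (b - i) * l + c + n.
    have : i * l <= b * l by rewrite leq_mul2r ib orbT.
    by rewrite mulnBl; clear; lia.
  rewrite modnDr val; last by apply: leq_ltn_trans bu; exact: leq_subr.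
  rewrite succE; move: bu iu nu3 ib; case: (c < a); case: (i.+1 =P nu); clear; lia.
have -> : b * l + c + n - i * l = (b + nu - i) * l + c.
  have : i * l <= b * l + nu * l by rewrite -mulnDl leq_mul2r (leq_trans (ltnW iu)) ?leq_addl ?orbT.
  by rewrite nE mulnBl mulnDl; clear; lia.
rewrite val; last by move: bi bu iu; clear; lia.
by rewrite succE; move: bu iu nu3 bi; case: (c < a); case: (i.+1 =P nu); clear; lia.
Qed.

Variables (pi : {perm 'I_n}) (m : {perm 'I_nu}).

Let blk (x : 'I_n) : 'I_nu := Ordinal (blk_lt ln al x).

(** Link blocks stay in place; the free block [j] moves behind the link block [m j]. *)
Definition reorder_fun (x : 'I_n) : 'I_n :=
  if x %% l < a then x else Ordinal (pos_lt ln (ltn_ord (m (blk x))) (ltn_pmod x l0)).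

Lemma reorder_mod x : reorder_fun x %% l = x %% l.
Proof. by rewrite /reorder_fun; case: ifP => //= _; rewrite pos_mod // ltn_pmod. Qed.

Lemma reorder_inj : injective reorder_fun.
Proof.
move=> x y e; have := reorder_mod x; rewrite e reorder_mod => yx.
have rv z : reorder_fun z = (if z %% l < a then z : nat else m (blk z) * l + z %% l) :> nat.
  by rewrite /reorder_fun; case: ifP.
move: e => /(congr1 val) /=; rewrite !rv yx; case: ifP => _; first exact: val_inj.
move=> /eqP; rewrite eqn_add2r eqn_pmul2r // => /eqP/val_inj/perm_inj/(congr1 val) /= e.
by apply: val_inj; rewrite /= (divn_eq x l) (divn_eq y l) e yx.
Qed.

Definition reorder := perm reorder_inj.

(** Products of permutations act from the left: [pi^-1] takes a vertex to its old position,
    [reorder] takes that to the new one. *)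
Lemma window_pos (i : 'I_nu) :
  consec (l + a) (pi^-1 * reorder)%g (i * l) =
  pi @: (linkspos n l a i :|: freepos n l a ((m^-1)%g i)).
Proof.
apply/setP => v; rewrite -{2}(permKV pi v) mem_imset; last exact: perm_inj.
rewrite inE permM; set x := (pi^-1)%g v; rewrite permE.
have -> : (reorder_fun x : nat) = reorder_fun x %/ l * l + reorder_fun x %% l.
  exact: divn_eq.
rewrite reorder_mod window_mod ?ltn_pmod ?(blk_lt ln al) //.
rewrite /reorder_fun; have [xa|xa] := ltnP (x %% l) a.
  by rewrite !inE xa leqNgt xa !andbT andbF orbF.
rewrite /= pos_div ?ltn_pmod // !inE xa ltnNge xa !andbF /= orbF andbT.
apply/eqP/eqP => [/val_inj <-|e]; first by rewrite permK.
by rewrite -[in RHS](permKV m i); congr (nat_of_ord (m _)); apply: val_inj.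
Qed.

(** Consecutive windows share exactly the link block between them, so the difference is one link
    block and one free block, of total size [a + (l - a)]. Here [nu > 2] is needed again: the link
    block left behind must not be the last one of the next window. *)
Lemma ham_cycle_of_matching (H : {set {set 'I_n}}) :
  (forall j : 'I_nu, pi @: (linkspos n l a (m j) :|: freepos n l a j) \in H) ->
  ham_cycle (l + a) l H [set pi @: (linkspos n l a (m j) :|: freepos n l a j) | j : 'I_nu].
Proof.
move=> hH; split=> //; pose om i : 'I_nu := Ordinal (ltn_pmod i nu0).
pose D (i : 'I_nu) := linkspos n l a i :|: freepos n l a ((m^-1)%g i).
exists (pi^-1 * reorder)%g, (fun i => pi @: D (om i)).
have omE (i : 'I_nu) : om i = i by apply: val_inj; rewrite /= modn_small.
have imP : injective (fun X : {set 'I_n} => pi @: X) by apply: imset_inj; exact: perm_inj.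
have inj : injective (fun j : 'I_nu => pi @: (linkspos n l a (m j) :|: freepos n l a j)).
  by move=> j j' /imP /(linkspos_freepos_inj ln nu3 a0 al)[].
split; last split; last split.
- apply/setP => X; apply/imsetP/imsetP => [[j _ ->]|[i _ ->]].
    by exists (m j) => //; rewrite omE /D permK.
  by exists ((m^-1)%g i) => //; rewrite permKV omE.
- by rewrite card_imset // card_ord.
- move=> i iu; split.
    by have := hH ((m^-1)%g (om i)); rewrite permKV.
  exists (om i * l); split; last by rewrite window_pos.
  by have := pos_lt ln (ltn_ord (om i)) l0; rewrite addn0.
move=> i iu; set i0 := om _; set i1 := om i.
have i01 : i1 = i0.+1 %% nu :> nat.
  rewrite /= modn_mod -[in RHS]addn1 modnDml addn1 prednK ?addn_gt0 ?nu0 ?orbT //.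
  by rewrite modnDr.
have -> : pi @: D i0 :\: pi @: D i1 = pi @: (D i0 :\: D i1).
  apply/setP => v; rewrite -(permKV pi v) in_setD.
  by rewrite !(mem_imset _ _ (@perm_inj _ pi)) in_setD.
rewrite card_imset; last exact: perm_inj.
have ne01 : i0 != i1 :> nat by rewrite i01 succ_neq.
have ne02 : i0 != i1.+1 %% nu :> nat.
  have small w : w < nu -> w.+1 %% nu = if w.+1 == nu then 0 else w.+1.
    by rewrite leq_eqVlt => /orP[/eqP ->|lt]; rewrite ?modnn ?eqxx // modn_small // ltn_eqF.
  move: i01 (ltn_ord i0) (ltn_ord i1); rewrite small // (small i1) //.
  move: (nat_of_ord i0) (nat_of_ord i1) nu3 => u v.
  by case: (u.+1 =P nu); case: (v.+1 =P nu); clear; lia.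
have -> : D i0 :\: D i1 = linkpos n l a i0 :|: freepos n l a ((m^-1)%g i0).
  apply/setP => x; rewrite !inE -i01; have [xa|xa] := ltnP (x %% l) a.
    rewrite !andbT !andbF !orbF; case: (x %/ l =P i0) => [->|_].
      by rewrite (negPf ne01) (negPf ne02).
    by case: (x %/ l =P i1); rewrite ?andbF.
  rewrite !andbT !andbF !orFb; case: (x %/ l =P (m^-1)%g i0) => [->|]; last by rewrite andbF.
  rewrite andbT; apply: contra ne01 => /eqP/val_inj/perm_inj -> //.
rewrite cardsU card_linkpos ?card_freepos ?(ltn_ord) //.
have := disjoint_linkpos_freepos n l a i0 ((m^-1)%g i0); rewrite -setI_eq0 => /eqP ->.
by rewrite cards0 subn0 subnKC // ltnW.
Qed.

End HamCycle.
(** * Packing *)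

Section Packing.
Local Open Scope ring_scope.
Variables (n l a : nat) (H : {set {set 'I_n}}) (p eps : R).
Let nu := (n %/ l)%N.
Let k := (l + a)%N.
Let b := (l - a)%N.
Hypotheses (ln : (l %| n)%N) (nu3 : (2 < nu)%N) (a0 : (0 < a)%N) (al : (a < l)%N) (kn : (k <= n)%N).
Hypothesis unifH : k_uniform k H.
Hypotheses (p0 : 0 < p) (p1 : p <= 1) (eps0 : 0 < eps) (eps1 : eps <= 1 / 8).
Hypothesis degA : forall S : {set 'I_n}, #|S| = (2 * a)%N ->
  (1 - eps) * 'C(n - 2 * a, b)%:R * p <= (deg k H S)%:R.
Hypothesis degB : forall S : {set 'I_n}, #|S| = b ->
  (1 - eps) * 'C(n - b, 2 * a)%:R * p <= (deg k H S)%:R.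
Hypothesis codegB : forall S1 S2 : {set 'I_n}, #|S1| = b -> #|S2| = b -> [disjoint S1 & S2] ->
  #|nbhd k H S1 :&: nbhd k H S2|%:R <= (1 + eps) * 'C(n - 2 * b, 2 * a)%:R * p ^+ 2.
Hypothesis binA : (1 - eps / 32) * 'C(n, b)%:R <= 'C(n - 2 * a, b)%:R.
Hypothesis binB : (1 - eps / 32) * 'C(n, 2 * a)%:R <= 'C(n - b, 2 * a)%:R.

Let N : R := nu%:R.
Let links (i : 'I_nu) := linkspos n l a i.
Let free (j : 'I_nu) := freepos n l a j.

Let kE : k = (2 * a + b)%N. Proof. by rewrite /k /b; move: al; clear; lia. Qed.
Let cardlinks i : #|links i| = (2 * a)%N. Proof. exact: (card_linkspos ln nu3 al). Qed.
Let cardfree j : #|free j| = b. Proof. exact: (card_freepos ln al). Qed.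
Let N0 : 0 < N. Proof. by rewrite ltr0n (ltn_trans _ nu3). Qed.
Let Nn : N <= n%:R. Proof. by rewrite ler_nat leq_div. Qed.

(** The excess [1 / 16] over [eps] is twice [1 / 32]: once for passing to the full binomial
    coefficient, once for the deviation. The deviation [eps / 32 * p ^ 2 * N] is that of the
    codegrees; it also serves the larger degrees, so one [tail] covers all events. *)
Definition low := (1 - 17 / 16 * eps) * p * N.
Definition high := (1 + 17 / 16 * eps) * p ^+ 2 * N.
Definition tail := exp (- ((eps / 32 * p ^+ 2 * N) ^+ 2 / (16 * 4 ^+ 2 * n%:R))).

(** The sets of interest are images of blocks under [pi] and so depend on [pi]. Hence the bounds are
    demanded for every set of the right size, which makes each event one about a fixed
    neighbourhood, at the price of a polynomial union bound. *)
Definition good : {set {perm 'I_n}} := [set pi : {perm 'I_n} |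
  [&& [forall S : {set 'I_n}, (#|S| == 2 * a)%N ==> (low <= (blocks_in free (nbhd k H S) pi)%:R)],
      [forall S : {set 'I_n}, (#|S| == b) ==> (low <= (blocks_in links (nbhd k H S) pi)%:R)] &
      [forall S : {set 'I_n} * {set 'I_n},
        [&& #|S.1| == b, #|S.2| == b & [disjoint S.1 & S.2]] ==>
        ((blocks_in links (nbhd k H S.1 :&: nbhd k H S.2) pi)%:R <= high)]]].

Lemma card_nbhd S X : X \in nbhd k H S -> #|X| = (k - #|S|)%N.
Proof. by rewrite inE => /andP[/eqP]. Qed.

Lemma t_bound : 0 <= eps / 32 * p ^+ 2 * N <= 4 * #|'I_n|%:R.
Proof.
have pp : p ^+ 2 <= 1 by rewrite expr_le1 // ltW.
have ep : eps / 32 * p ^+ 2 <= 1 * 1.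
  by apply: ler_pM => //; rewrite ?sqr_ge0 //; move: eps0 eps1; lra.
have ep0 : 0 <= eps / 32 * p ^+ 2 by rewrite mulr_ge0 ?sqr_ge0 //; move: eps0; lra.
rewrite mulr_ge0 ?(ltW N0) //= card_ord.
have : eps / 32 * p ^+ 2 * N <= 1 * N by rewrite ler_wpM2r ?(ltW N0) //; lra.
by move: Nn N0; lra.
Qed.

Lemma few_low (Q : 'I_nu -> {set 'I_n}) s (F : {set {set 'I_n}}) :
  (forall i, #|Q i| = s) -> (forall x, #|[set i | x \in Q i]| <= 2)%N ->
  (forall X, X \in F -> #|X| = s) -> (s <= n)%N ->
  (1 - eps) * ((1 - eps / 32) * 'C(n, s)%:R) * p <= #|F|%:R ->
  #|[set pi | (blocks_in Q F pi)%:R < low]|%:R <= #|{perm 'I_n}|%:R * tail.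
Proof.
move=> cQ mQ cF sn lF; have /andP[t0 t1] := t_bound.
have := perm_tail_lower (blocks_in_lipschitz mQ F) (ltr0n _ 4) t0 t1.
rewrite card_ord; apply: le_trans; rewrite ler_nat; apply: subset_leq_card.
apply/subsetP => pi; rewrite !inE => /lt_le_trans; apply.
rewrite (blocks_in_mean cQ cF) ?card_ord // -/N.
have C0 : 0 < 'C(n, s)%:R :> R by rewrite ltr0n bin_gt0.
have : (1 - eps) * (1 - eps / 32) * p <= #|F|%:R / 'C(n, s)%:R.
  by rewrite ler_pdivlMr //; apply: le_trans lF; rewrite le_eqVlt; apply/orP; left; apply/eqP; ring.
move=> /(ler_wpM2l (ltW N0)); rewrite mulrA.
have eN : 0 <= eps / 32 * N by apply: mulr_ge0; [move: eps0; lra | exact: ltW].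
have : p ^+ 2 * (eps / 32 * N) <= p * (eps / 32 * N).
  by rewrite ler_wpM2r // expr2 ger_pMr.
have : 0 <= eps * eps * N * p by rewrite !mulr_ge0 // ltW.
by rewrite /low; lra.
Qed.

Lemma few_high (F : {set {set 'I_n}}) :
  (forall X, X \in F -> #|X| = (2 * a)%N) -> (2 * a <= n)%N ->
  #|F|%:R <= (1 + eps) * 'C(n, 2 * a)%:R * p ^+ 2 ->
  #|[set pi | high < (blocks_in links F pi)%:R]|%:R <= #|{perm 'I_n}|%:R * tail.
Proof.
move=> cF sn lF; have /andP[t0 t1] := t_bound.
have mQ x : (#|[set i | x \in links i]| <= 2)%N by exact: (mult_linkspos ln nu3 al).
have := perm_tail (blocks_in_lipschitz mQ F) (ltr0n _ 4) t0 t1.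
rewrite card_ord; apply: le_trans; rewrite ler_nat; apply: subset_leq_card.
apply/subsetP => pi; rewrite !inE; apply: le_lt_trans.
rewrite (blocks_in_mean cardlinks cF) ?card_ord // -/N.
have C0 : 0 < 'C(n, 2 * a)%:R :> R by rewrite ltr0n bin_gt0.
have : #|F|%:R / 'C(n, 2 * a)%:R <= (1 + eps) * p ^+ 2.
  by rewrite ler_pdivrMr //; apply: le_trans lF _;
    rewrite le_eqVlt; apply/orP; left; apply/eqP; ring.
move=> /(ler_wpM2l (ltW N0)); rewrite mulrA.
have : 0 <= p ^+ 2 * eps * N by rewrite !mulr_ge0 ?sqr_ge0 // ltW.
by rewrite /high; lra.
Qed.

Lemma card_bigcup_le (U W : finType) (A : {set U}) (B : U -> {set W}) (c : R) :
  (forall u, u \in A -> #|B u|%:R <= c) -> #|\bigcup_(u in A) B u|%:R <= #|A|%:R * c.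
Proof.
move=> hB; have : (#|\bigcup_(u in A) B u| <= \sum_(u in A) #|B u|)%N.
  elim/big_rec2: _ => [|u m X _ le]; first by rewrite cards0.
  by apply: leq_trans (leq_card_setU _ _) _; rewrite leq_add2l.
rewrite -(ler_nat R) natr_sum => /le_trans; apply.
rewrite mulr_natl -sumr_const; exact: ler_sum.
Qed.

Variable gamma : R.
Hypothesis hgamma : ('C(n, 2 * a) + 'C(n, b) + 'C(n, b) ^ 2)%:R * tail <= gamma.

Lemma card_good : (1 - gamma) * #|{perm 'I_n}|%:R <= #|good|%:R.
Proof.
have bn : (b <= n)%N by apply: leq_trans kn; rewrite kE leq_addl.
have an : (2 * a <= n)%N by apply: leq_trans kn; rewrite kE leq_addr.
pose A1 := [set S : {set 'I_n} | #|S| == 2 * a]%N.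
pose A2 := [set S : {set 'I_n} | #|S| == b].
pose A3 := [set S : {set 'I_n} * {set 'I_n} |
   [&& #|S.1| == b, #|S.2| == b & [disjoint S.1 & S.2]]].
pose B1 (S : {set 'I_n}) := [set pi | (blocks_in free (nbhd k H S) pi)%:R < low].
pose B2 (S : {set 'I_n}) := [set pi | (blocks_in links (nbhd k H S) pi)%:R < low].
pose B3 (S : {set 'I_n} * {set 'I_n}) :=
  [set pi | high < (blocks_in links (nbhd k H S.1 :&: nbhd k H S.2) pi)%:R].
pose P : R := #|{perm 'I_n}|%:R.
have P0 : 0 <= P by [].
have h1 : #|\bigcup_(S in A1) B1 S|%:R <= #|A1|%:R * (P * tail).
  apply: card_bigcup_le => S; rewrite inE => /eqP cS.
  apply: (few_low cardfree (mult_freepos ln al)) => //.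
    by move=> X /card_nbhd ->; rewrite cS kE addKn.
  apply: le_trans (degA cS); rewrite ler_wpM2r ?(ltW p0) // ler_wpM2l //.
  by move: eps1; lra.
have h2 : #|\bigcup_(S in A2) B2 S|%:R <= #|A2|%:R * (P * tail).
  apply: card_bigcup_le => S; rewrite inE => /eqP cS.
  apply: (few_low cardlinks (mult_linkspos ln nu3 al)) => //.
    by move=> X /card_nbhd ->; rewrite cS kE addnK.
  apply: le_trans (degB cS); rewrite ler_wpM2r ?(ltW p0) // ler_wpM2l //.
  by move: eps1; lra.
have h3 : #|\bigcup_(S in A3) B3 S|%:R <= #|A3|%:R * (P * tail).
  apply: card_bigcup_le => -[S1 S2]; rewrite inE /= => /and3P[/eqP c1 /eqP c2 dS].
  apply: few_high => //.
    by move=> X /setIP[/card_nbhd -> _]; rewrite c1 kE addnK.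
  apply: le_trans (codegB c1 c2 dS) _; rewrite ler_wpM2r ?sqr_ge0 // ler_wpM2l //.
    by move: eps0; lra.
  by rewrite ler_nat leq_bin2l // leq_subr.
have sub : ~: good \subset \bigcup_(S in A1) B1 S :|: \bigcup_(S in A2) B2 S
    :|: \bigcup_(S in A3) B3 S.
  apply/subsetP => pi; rewrite !inE !negb_and => /or3P[] /forallPn[S];
    rewrite negb_imply => /andP[cS]; rewrite -ltNge => lt; apply/orP.
  - by left; apply/orP; left; apply/bigcupP; exists S; rewrite inE.
  - by left; apply/orP; right; apply/bigcupP; exists S; rewrite inE.
  - by right; apply/bigcupP; exists S; rewrite inE.
have cA1 : #|A1| = 'C(n, 2 * a) by rewrite card_draws card_ord.
have cA2 : #|A2| = 'C(n, b) by rewrite card_draws card_ord.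
have cA3 : (#|A3| <= 'C(n, b) ^ 2)%N.
  rewrite -cA2 -mulnn -cardsX; apply: subset_leq_card; apply/subsetP => -[S1 S2].
  by rewrite !inE /= => /and3P[-> -> _].
have := subset_leq_card sub; rewrite -(ler_nat R) => h4.
have : #|~: good|%:R <= gamma * P.
  apply: le_trans h4 _; apply: le_trans (_ : _ <=
     #|\bigcup_(S in A1) B1 S|%:R + #|\bigcup_(S in A2) B2 S|%:R
       + #|\bigcup_(S in A3) B3 S|%:R) _.
    rewrite -!natrD ler_nat; apply: leq_trans (leq_card_setU _ _) _.
    by rewrite leq_add2r leq_card_setU.
  apply: le_trans (lerD (lerD h1 h2) h3) _.
  rewrite -!mulrDl mulrCA [leRHS]mulrC ler_wpM2l //; apply: le_trans hgamma.
  rewrite ler_wpM2r ?(ltW (exp_gt0 _)) // cA1 cA2 -!natrD ler_nat.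
  by rewrite leq_add2l.
have : #|good|%:R + #|~: good|%:R = P by rewrite -natrD cardsC.
by rewrite -/P; lra.
Qed.

Definition edge (pi : {perm 'I_n}) (j i : 'I_nu) := pi @: (links i :|: free j).

Definition cov (pi : {perm 'I_n}) : {set {set 'I_n}} := [set edge pi x.1 x.2 | x : 'I_nu * 'I_nu].

Lemma card_linkfree i j : #|links i :|: free j| = k.
Proof.
rewrite cardsU cardlinks cardfree kE.
suff -> : links i :&: free j = set0 by rewrite cards0 subn0.
apply/eqP; rewrite /links /linkspos setIUl setU_eq0 !setI_eq0.
by rewrite !disjoint_linkpos_freepos.
Qed.

(** A union bound over the [nu ^ 2] pairs of blocks, the image of each union being uniform over the
    [k]-sets. *)
Lemma card_cov (x : {set 'I_n}) : #|x| = k ->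
  #|[set pi | x \in cov pi]|%:R * 'C(n, k)%:R <= #|{perm 'I_n}|%:R * N ^+ 2.
Proof.
move=> cx.
have sub : [set pi | x \in cov pi] \subset
    \bigcup_(y in [set: 'I_nu * 'I_nu]) [set pi : {perm 'I_n} | pi @: (links y.2 :|: free y.1) \in [set x]].
  apply/subsetP => pi; rewrite inE => /imsetP[y _ ->]; apply/bigcupP; exists y => //.
  by rewrite !inE.
have C0 : 0 < 'C(n, k)%:R :> R by rewrite ltr0n bin_gt0.
rewrite -ler_pdivlMr //.
apply: (@le_trans _ _ #|\bigcup_(y in [set: 'I_nu * 'I_nu])
   [set pi : {perm 'I_n} | pi @: (links y.2 :|: free y.1) \in [set x]]|%:R).
  by rewrite ler_nat subset_leq_card.
apply: le_trans (@card_bigcup_le _ _ _ _ (#|{perm 'I_n}|%:R / 'C(n, k)%:R) _) _.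
  move=> y _; rewrite ler_pdivlMr // -natrM ler_nat -[n in 'C(n, _)]card_ord.
  rewrite (card_imset_in (card_linkfree _ _)) ?cards1 ?muln1 //.
  by move=> Q; rewrite inE => /eqP ->.
by rewrite cardsT card_prod card_ord natrM -expr2 mulrC mulrAC.
Qed.

Lemma edgeE pi j i : (edge pi j i \in H) = (pi @: links i \in nbhd k H (pi @: free j)).
Proof.
rewrite inE !card_imset; try exact: perm_inj.
by rewrite cardfree cardlinks kE addnK eqxx /= -imsetU setUC.
Qed.

Lemma edgeE' pi j i : (edge pi j i \in H) = (pi @: free j \in nbhd k H (pi @: links i)).
Proof.
rewrite inE !card_imset; try exact: perm_inj.
by rewrite cardfree cardlinks kE addKn eqxx /= -imsetU.
Qed.

Lemma edge_inj pi j i j' i' : edge pi j i = edge pi j' i' -> j = j' /\ i = i'.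
Proof.
move=> /(imset_inj (@perm_inj _ pi)); exact: (linkspos_freepos_inj ln nu3 a0 al).
Qed.

Variables (r K D : nat) (mu q beta delta : R).
Hypotheses (K0 : (0 < K)%N) (mu0 : 0 < mu) (q0 : 0 <= q) (gamma1 : gamma < 1).
Hypothesis hq : N ^+ 2 <= q * (1 - gamma) * 'C(n, k)%:R.
Hypothesis hK : #|H|%:R * (1 + mu * q) ^+ r < (1 + mu) ^+ K.+1.
Hypotheses (beta0 : 0 < beta) (beta1 : beta <= 1 - 5 / 4 * eps)
  (beta2 : 3 * (5 / 4 * eps) <= beta ^+ 2).
Let d := p * N / K%:R.
Hypotheses (hN : N <= (5 / 4 * eps) ^+ 2 * beta * d ^+ 2) (hd : 10 <= beta * d)
  (hD : D%:R <= (1 - 5 / 4 * eps - beta) * d).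
Hypotheses (delta_low : exp (- (low / K%:R * (eps / 16) ^+ 2 / 8)) <= delta)
  (delta_high : exp (- (high / K%:R ^+ 2 * (eps / 16) ^+ 2 / 8)) <= delta)
  (hdelta : (r * (nu + nu + nu ^ 2))%:R * delta < 1).

(** An edge covered more than [K] times would by itself contribute [(1 + mu) ^ K.+1], more than [hK]
    allows the whole potential. Restricting to [good] raises the probability of covering an edge by
    at most [1 / (1 - gamma)], which [q] accounts for. *)
Lemma exists_cover : exists pis : 'I_r -> {perm 'I_n},
  (forall t, pis t \in good) /\
  forall x, x \in H -> (#|[set t | x \in cov (pis t)]| <= K)%N.
Proof.
have P0 : 0 < #|{perm 'I_n}|%:R :> R.
  by rewrite ltr0n; apply/card_gt0P; exists 1%g.
have g0 : (0 < #|good|)%N.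
  by rewrite -(ltr0n R); apply: lt_le_trans card_good; rewrite mulr_gt0 // subr_gt0.
have [x xH|s [ss sg sP]] := greedy_cover (ltW mu0) q0 g0 (cov := cov) (H := H) _ r.
  have C0 : 0 < 'C(n, k)%:R :> R by rewrite ltr0n bin_gt0.
  rewrite -(ler_pM2r C0); apply: le_trans (_ : _ <=
     #|[set pi | x \in cov pi]|%:R * 'C(n, k)%:R) _.
    rewrite ler_pM2r // ler_nat subset_leq_card //; apply/subsetP => pi.
    by rewrite !inE => /andP[].
  apply: le_trans (card_cov (unifH xH)) _; rewrite mulrC.
  apply: le_trans (ler_wpM2r (ltW P0) hq) _.
  by rewrite [leLHS]mulrAC ler_pM2r // -mulrA ler_wpM2l // card_good.
pose pis (t : 'I_r) := nth 1%g s t; exists pis; split.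
  by move=> t; apply: sg; rewrite mem_nth // ss.
move=> x xH; rewrite leqNgt; apply/negP => lt.
have : (1 + mu) ^+ K.+1 <= \sum_(x in H) (1 + mu) ^+ count (fun w => x \in cov w) s.
  rewrite (bigD1 x) //= -[leLHS]addr0 lerD //; last first.
    by apply: sumr_ge0 => y _; rewrite exprn_ge0 // addr_ge0 // ltW.
  rewrite ler_eXn2l ?ltrDl //; apply: leq_trans lt _.
  rewrite -sum1_count (big_nth 1%g) big_mkord ss -sum1_card.
  by under eq_bigl do rewrite inE.
by move=> /le_trans/(_ sP); rewrite leNgt hK.
Qed.

Lemma packing : exists Cs : seq {set {set 'I_n}},
  [/\ forall C, C \in Cs -> ham_cycle k l H C,
      pairwise (fun C1 C2 : {set {set 'I_n}} => [disjoint C1 & C2]) Cs &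
      size Cs = (r * D)%N].
Proof.
have [pis [pig pic]] := exists_cover.
pose e t j i := edge (pis t) j i.
have K0' : 0 < K%:R :> R by rewrite ltr0n.
have e1 := eps1; have e0 := eps0.
have low0 : 0 <= low.
  by apply: (mulr_ge0 _ (ltW N0)); apply: (mulr_ge0 _ (ltW p0)); lra.
have high0 : 0 <= high.
  by apply: (mulr_ge0 _ (ltW N0)); apply: (mulr_ge0 _ (sqr_ge0 _)); lra.
have cardS (Q : pred 'I_nu) : #|[set i | Q i]| = (\sum_i Q i)%N.
  by rewrite -sum1_card big_mkcond; apply: eq_bigr => i _; rewrite inE; case: (Q i).
have cov_users x : x \in H -> (#|users e x| <= K)%N.
  move=> xH; apply: leq_trans (pic x xH); apply: subset_leq_card.
  apply/subsetP => t; rewrite !inE => /existsP[j /existsP[i /eqP ->]].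
  by apply/imsetP; exists (j, i).
have e_inj t j i j' i' : e t j i = e t j' i' -> j = j' /\ i = i'.
  exact: edge_inj.
have hr t j : low / K%:R * K%:R <= (rdeg (host e H t) j)%:R.
  rewrite divfK ?gt_eqF //.
  have := pig t; rewrite inE => /and3P[_ /forallP/(_ (pis t @: free j)) + _].
  rewrite card_imset ?cardfree ?eqxx /=; last exact: perm_inj.
  move/le_trans; apply; rewrite ler_nat /blocks_in cardS /rdeg leq_sum // => i _.
  by rewrite -edgeE inE.
have hc t i : low / K%:R * K%:R <= (cdeg (host e H t) i)%:R.
  rewrite divfK ?gt_eqF //.
  have := pig t; rewrite inE => /and3P[/forallP/(_ (pis t @: links i)) + _ _].
  rewrite card_imset ?cardlinks ?eqxx /=; last exact: perm_inj.
  move/le_trans; apply; rewrite ler_nat /blocks_in cardS /cdeg leq_sum // => j _.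
  by rewrite -edgeE' inE.
have hcd t j j' : j != j' -> (codeg (host e H t) j j')%:R <= high / K%:R ^+ 2 * K%:R ^+ 2.
  move=> jj; rewrite divfK ?expf_neq0 ?gt_eqF //.
  have := pig t; rewrite inE => /and3P[_ _ /forallP/(_ (pis t @: free j, pis t @: free j')) /=].
  rewrite !card_imset ?cardfree ?eqxx /=; try exact: perm_inj.
  have -> : [disjoint pis t @: free j & pis t @: free j'].
    rewrite -setI_eq0 -imsetI; last by move=> x y _ _; exact: perm_inj.
    suff -> : free j :&: free j' = set0 by rewrite imset0.
    apply/setP => x; rewrite !inE; apply: contraNF jj => /andP[/andP[/eqP h1 _] /andP[/eqP h2 _]].
    by apply/eqP/val_inj; rewrite /= -h1 h2.
  apply: le_trans; rewrite ler_nat /codeg /blocks_in; apply: subset_leq_card.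
  apply/subsetP => i; rewrite inE => /andP[h1 h2]; rewrite inE in_setI -!edgeE.
  by move: h1 h2; rewrite !inE => -> ->.
have tau0 : 0 <= eps / 16 by lra.
have tau1 : eps / 16 <= 1 / 2 by lra.
have L0 : 0 <= low / K%:R by rewrite divr_ge0.
have u0 : 0 <= high / K%:R ^+ 2 by rewrite divr_ge0 // exprn_ge0.
have hdelta' : (r * (#|'I_nu| + #|'I_nu| + #|'I_nu| ^ 2))%:R * delta < 1 by rewrite card_ord.
have [G [GH Gdis Gr Gc Gcd]] := split_hosts K0 e_inj cov_users tau0 tau1 L0 u0 hr hc hcd
  delta_low delta_high hdelta'.
have d0 : 0 < d by rewrite divr_gt0 // mulr_gt0.
(* The error [eps / 16] of the colouring on top of [17 / 16 * eps] from the permutations stays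
   within [5 / 4 * eps], which [eps <= 1 / 8] keeps below the [5 / 32] allowed for [eta]. *)
have hlow : (1 - 5 / 4 * eps) * d <= (1 - eps / 16) * (low / K%:R).
  have -> : low / K%:R = (1 - 17 / 16 * eps) * d by rewrite /low /d !mulrA.
  by rewrite [leRHS]mulrA ler_pM2r //; have := sqr_ge0 eps; lra.
have hhigh : (1 + eps / 16) * (high / K%:R ^+ 2) * N <= (1 + 5 / 4 * eps) * d ^+ 2.
  have -> : (1 + eps / 16) * (high / K%:R ^+ 2) * N =
      ((1 + eps / 16) * (1 + 17 / 16 * eps)) * d ^+ 2.
    by rewrite /high /d expr_div_n exprMn; ring.
  rewrite ler_pM2r ?exprn_gt0 //.
  by have : eps * eps <= eps * (1 / 8) by [rewrite ler_pM2l]; lra.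
have ms_ex t : exists ms : seq {perm 'I_nu}, [/\ size ms = D,
    forall m, m \in ms -> forall j, (j, m j) \in G t &
    pairwise (fun m m' : {perm 'I_nu} => [forall j, m j != m' j]) ms].
  apply: (@pseudorandom_matchings R 'I_nu (G t) d (5 / 4 * eps) beta D) => //.
  - by lra.
  - by lra.
  - by rewrite card_ord.
  - by move=> j; apply: le_trans hlow (Gr t j).
  - by move=> i; apply: le_trans hlow (Gc t i).
  - move=> j j' jj; rewrite card_ord; apply: le_trans hhigh; rewrite ler_wpM2r ?(ltW N0) //.
    exact: Gcd.
have [ms hms] := fin_all_exists ms_ex.
pose cyc t (m : {perm 'I_nu}) := [set edge (pis t) j (m j) | j : 'I_nu].
have mG t m j : m \in ms t -> (j, m j) \in G t.
  by move=> mm; have [_ h _] := hms t; exact: h.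
exists (flatten [seq [seq cyc t m | m <- ms t] | t <- enum 'I_r]); split.
- move=> C /flatten_mapP[t _ /mapP[m mm ->]].
  apply: (ham_cycle_of_matching ln nu3 a0 al) => j.
  by have := subsetP (GH t) _ (mG t m j mm); rewrite inE.
(* Within one graph an edge determines its two blocks, so disjoint matchings give disjoint cycles;
   between different graphs disjointness is [Gdis]. *)
- have : uniq (enum 'I_r) by exact: enum_uniq.
  elim: (enum 'I_r) => //= t ts IH /andP[tts uts]; rewrite pairwise_cat IH // andbT.
  apply/andP; split; last first.
    rewrite pairwise_map; have [_ _] := hms t; apply: sub_pairwise => m m' /forallP mm'.
    rewrite /= -setI_eq0; apply/eqP/setP => x; rewrite !inE; apply/negbTE.
    apply/negP => /andP[/imsetP[j _ ->] /imsetP[j' _ /edge_inj[jj]]].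
    by move: (mm' j); rewrite -jj => /eqP.
  apply/allrelP => C C' /mapP[m mm ->] /flatten_mapP[t' t'ts /mapP[m' mm' ->]].
  rewrite -setI_eq0; apply/eqP/setP => x; rewrite !inE; apply/negbTE.
  apply/negP => /andP[/imsetP[j _ ->] /imsetP[j' _ ee]].
  have := Gdis t t' (j, m j) (j', m' j') (mG t m j mm) (mG t' m' j' mm') ee.
  by move=> tt; rewrite tt t'ts in tts.
rewrite size_flatten /shape -map_comp sumnE big_map big_enum /=.
rewrite (eq_bigr (fun=> D)) ?sum_nat_const ?card_ord // => t _.
by rewrite size_map; have [] := hms t.
Qed.

End Packing.
(** * Asymptotics *)

Section Binomials.

Lemma bin_leq_exp n j : 'C(n, j) <= n ^ j.
Proof.
elim: n j => [|n IH] [|j]; rewrite ?bin0 // binS expnS.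
have h : n ^ j <= n.+1 ^ j by case: j => // j; rewrite leq_exp2r.
rewrite mulSn addnC; apply: leq_add; first exact: leq_trans (IH j) h.
by apply: leq_trans (IH j.+1) _; rewrite expnS leq_mul2l h orbT.
Qed.

Lemma bin_sub_leq n c b : c <= n -> 'C(n, b.+1) <= 'C(n - c, b.+1) + c * 'C(n.-1, b).
Proof.
elim: c => [|c IH] cn; first by rewrite subn0 leq_addr.
apply: leq_trans (IH (ltnW cn)) _; rewrite mulSn addnA leq_add2r.
have -> : n - c = (n - c.+1).+1 by rewrite subnSK.
rewrite binS leq_add2l leq_bin2l //.
by rewrite subnS -subn1 -subnDA addn1; case: (n) cn => // m; rewrite subSS leq_subr.
Qed.

(** At most [c * 'C(n.-1, b.-1)] of the [b]-sets meet [c] given points, which is the fraction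
    [c * b / n] of all of them. *)
Lemma bin_ratio (n c b : nat) (e : R) : c <= n -> 0 < n ->
  ((c * b)%:R <= e * n%:R)%R -> ((1 - e) * 'C(n, b)%:R <= 'C(n - c, b)%:R)%R.
Proof.
Local Open Scope ring_scope.
move=> cn n0; case: b => [|b] h.
  rewrite !bin0 mulr1; move: h; rewrite muln0 pmulr_lge0 ?ltr0n // => e0.
  by rewrite gerBl.
have n0' : 0 < n%:R :> R by rewrite ltr0n.
have := bin_sub_leq b cn; rewrite -(ler_nat R) natrD => h1.
have h2 : n%:R * 'C(n.-1, b)%:R = b.+1%:R * 'C(n, b.+1)%:R :> R.
  by rewrite -!natrM -mul_bin_diag.
have h3 : n%:R * (c * 'C(n.-1, b))%:R <= n%:R * (e * 'C(n, b.+1)%:R) :> R.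
  rewrite natrM mulrCA h2 [leLHS]mulrA -natrM [leRHS]mulrA [n%:R * e]mulrC.
  by rewrite ler_wpM2r.
by move: h3; rewrite ler_pM2l //; move: h1; lra.
Qed.
End Binomials.

(** * Rounding and combination of losses *)

Section Numerics.
Local Open Scope ring_scope.

Lemma exists_floor (x : R) : 0 <= x -> exists m : nat, m%:R <= x < m%:R + 1.
Proof. by exists (Num.truncn x); rewrite natr1; exact: truncn_itv. Qed.

Lemma ler_prod3 (x y z : R) : 0 <= x -> x <= 1 -> 0 <= y -> y <= 1 -> 0 <= z -> z <= 1 ->
  1 - x - y - z <= (1 - x) * ((1 - y) * (1 - z)).
Proof.
move=> x0 x1 y0 y1 z0 z1.
have h1 : 1 - y - z <= (1 - y) * (1 - z) by have := mulr_ge0 y0 z0; lra.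
have h2 : (1 - y) * (1 - z) <= 1 by rewrite mulr_ile1 //; lra.
have : x * ((1 - y) * (1 - z)) <= x * 1 by rewrite ler_wpM2l.
by lra.
Qed.

Lemma loss_bound (w : R) : 0 <= w -> w <= 1 / 2 ->
  1 - 2 * w <= (1 - w / 50) * ((1 - w / 5) * (1 - 171 / 100 * w)).
Proof. by move=> w0 w1; apply: le_trans (ler_prod3 _ _ _ _ _ _); lra. Qed.

End Numerics.

(* [w] stands for [eps ^ (1/3)], [L] for [ln n] and [s] for [sqrt n]. *)
Section Asymptotics.
Local Open Scope ring_scope.
Variables (n l a : nat) (H : {set {set 'I_n}}) (p w L s M : R).
Let eps := w ^+ 3.
Let nu := (n %/ l)%N.
Let k := (l + a)%N.
Let b := (l - a)%N.
Hypotheses (ln : (l %| n)%N) (nu3 : (2 < nu)%N) (a0 : (0 < a)%N) (al : (a < l)%N) (kn : (k <= n)%N).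
Hypothesis unifH : k_uniform k H.
Hypotheses (p0 : 0 < p) (p1 : p <= 1) (w0 : 0 < w) (w1 : w <= 1 / 2).
Hypotheses (s0 : 0 < s) (sn : s ^+ 2 = n%:R) (L1 : 1 <= L) (Ln : exp L = n%:R).
Hypothesis hm : #|H|%:R = p * 'C(n, k)%:R.
Hypotheses (M1 : (64 * 3) <= M) (M2 : 32 * (2 * a * b)%:R <= M)
  (M3 : (64 * 64 * 64) * l%:R ^+ 2 * (2 * k + 2)%:R <= M)
  (M4 : (201 * k%:R) ^+ 2 * l%:R <= M) (M5 : 100 * (201 * k%:R) * l%:R <= M)
  (M6 : (64 * 64) * (201 * k%:R) * (k + 2)%:R * l%:R <= M)
  (M7 : (64 * 32) * (201 * k%:R) ^+ 2 * (k + 2)%:R * l%:R <= M).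
Hypothesis growth : M * L ^+ 3 < eps ^+ 5 * s * p ^+ 2.

Let N : R := nu%:R.
Let C : R := 'C(n, k)%:R.
Let nE : n%:R = N * l%:R :> R. Proof. by rewrite -natrM divnK. Qed.
Let l1 : 1 <= l%:R :> R. Proof. by rewrite (ler_nat _ 1) (leq_ltn_trans _ al). Qed.
Let k3 : 3 <= k%:R :> R. Proof. by rewrite (ler_nat _ 3) /k; move: a0 al; clear; lia. Qed.
Let n3 : 3 <= n%:R :> R.
Proof. by rewrite (ler_nat _ 3) (leq_trans nu3) ?leq_div. Qed.
Let N3 : 3 <= N. Proof. by rewrite (ler_nat _ 3). Qed.
Let C0 : 0 < C. Proof. by rewrite ltr0n bin_gt0. Qed.

Let s1 : 1 <= s.
Proof.
rewrite -(@ler_pXn2r _ 2) ?nnegrE ?(ltW s0) // expr1n sn.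
by move: n3; lra.
Qed.

Let eps0 : 0 < eps. Proof. by rewrite exprn_gt0. Qed.

Let w2 : w ^+ 2 <= 1 / 4.
Proof. by have : w * w <= 1 / 2 * (1 / 2); [apply: ler_pM; rewrite ?(ltW w0)
  | rewrite expr2; lra]. Qed.

Let eps_w2 : eps <= w ^+ 2 * (1 / 2).
Proof. by rewrite /eps exprSr ler_pM2l // exprn_gt0. Qed.

Let eps_w : eps <= w * (1 / 4).
Proof. by rewrite /eps exprS ler_pM2l. Qed.

Let eps8 : eps <= 1 / 8.
Proof. by move: eps_w w1; lra. Qed.

Let pow_le1 (x : R) j : 0 <= x -> x <= 1 -> 0 <= x ^+ j <= 1.
Proof. by move=> x0 x1; rewrite exprn_ge0 // exprn_ile1. Qed.

Let ep j : 0 <= eps ^+ j <= 1.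
Proof. by apply: pow_le1; [exact: ltW | move: eps8; lra]. Qed.

Let M0 : 0 < M. Proof. by move: M1; lra. Qed.

Let Lpow : L <= L ^+ 3 /\ L ^+ 2 <= L ^+ 3.
Proof.
have L0 : 0 <= L by move: L1; lra.
by split; [rewrite -{1}(expr1 L)|]; rewrite ler_weXn2l.
Qed.

(** The growth condition is used through four weakenings: this one for the binomial ratios and for
    [n] large against [1 / w], [growth2] for the martingale tail, [growth3] for the codegree
    requirements and [growth4] for the degree requirements after the splitting. *)
Let growth1 : M <= eps * s.
Proof.
have h : eps ^+ 5 * s * p ^+ 2 <= eps * s.
  have /andP[e0 e1] := ep 4; have /andP[q0 q1] := pow_le1 2 (ltW p0) p1.
  rewrite (_ : eps ^+ 5 * s * p ^+ 2 = eps * s * (eps ^+ 4 * p ^+ 2)); last by ring.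
  by rewrite ger_pMr ?mulr_gt0 // mulr_ile1.
apply: le_trans h; apply: le_trans (ltW growth).
by rewrite ler_peMr ?(ltW M0) // exprn_ege1.
Qed.

Let growth2 : M * L <= (eps * p ^+ 2) ^+ 2 * n%:R.
Proof.
have h : M * L <= eps * p ^+ 2 * s.
  apply: (@le_trans _ _ (M * L ^+ 3)); first by rewrite ler_pM2l //; case: Lpow.
  apply: le_trans (ltW growth) _.
  have /andP[e0 e1] := ep 4.
  rewrite (_ : eps ^+ 5 * s * p ^+ 2 = eps * p ^+ 2 * s * eps ^+ 4); last by ring.
  by rewrite ger_pMr // !mulr_gt0 // exprn_gt0.
have h1 : 1 * 1 <= M * L by apply: ler_pM => //; move: M1; lra.
rewrite -sn -exprMn; have h2 : 1 <= eps * p ^+ 2 * s by lra.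
apply: le_trans h _.
by rewrite [leRHS]expr2 ler_peMl // (le_trans _ h2).
Qed.

Let growth3 : M * L ^+ 3 <= eps ^+ 4 * p ^+ 2 * n%:R.
Proof.
apply: le_trans (ltW growth) _; rewrite -sn.
rewrite (_ : eps ^+ 5 * s * p ^+ 2 = eps ^+ 4 * p ^+ 2 * s * eps); last by ring.
rewrite (_ : eps ^+ 4 * p ^+ 2 * s ^+ 2 = eps ^+ 4 * p ^+ 2 * s * s); last by ring.
rewrite ler_wpM2l ?mulr_ge0 ?exprn_ge0 ?ltW //.
by move: eps8 s1; lra.
Qed.

Let growth4 : M * L ^+ 3 <= eps ^+ 3 * p * n%:R.
Proof.
apply: le_trans growth3 _; rewrite ler_wpM2r //.
rewrite (_ : eps ^+ 4 * p ^+ 2 = eps ^+ 3 * p * (eps * p)); last by ring.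
rewrite ger_pMr ?mulr_gt0 ?exprn_gt0 // mulr_ile1 ?(ltW eps0) ?(ltW p0) //.
by move: eps8; lra.
Qed.

Let expnL j : n%:R ^+ j = exp (L * j%:R).
Proof. by rewrite -Ln -expMn mulr_natr. Qed.

Let bin_exp j i : (j <= i)%N -> 'C(n, j)%:R <= exp (L * i%:R).
Proof.
move=> ji; apply: (@le_trans _ _ (exp (L * j%:R))).
  by rewrite -expnL -natrX ler_nat bin_leq_exp.
by apply: ler_exp; rewrite ler_wpM2l ?ler_nat //; move: L1; lra.
Qed.

Let bin_small (c j : nat) : (c * j <= 2 * a * b)%N -> (c <= n)%N ->
  (1 - eps / 32) * 'C(n, j)%:R <= 'C(n - c, j)%:R.
Proof.
move=> cj cn; apply: bin_ratio => //; first by rewrite -(ltr0n R); move: n3; lra.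
apply: (@le_trans _ _ (2 * a * b)%:R); first by rewrite ler_nat.
have : eps * s <= eps * n%:R.
  by rewrite ler_pM2l // -sn expr2 ler_pMl.
by move: M2 growth1; lra.
Qed.

Let gamma := w / 64.

(** The sets and pairs of sets number at most [3 * n ^ (2 * k)] and the tail is at most
    [n ^ - (2 * k + 2)], so their product is below [3 / n ^ 2]. The constant [64 * 64 * 64] in [M3]
    is [32 ^ 2] from the deviation times [16 * 4 ^ 2] from the tail bound. *)
Let tail_small : ('C(n, 2 * a) + 'C(n, b) + 'C(n, b) ^ 2)%:R * tail n l p eps <= gamma.
Proof.
have ak : (2 * a <= k)%N by rewrite /k; move: al; clear; lia.
have bk : (b <= k)%N by rewrite /k /b; move: al; clear; lia.
have c1 : ('C(n, 2 * a) + 'C(n, b) + 'C(n, b) ^ 2)%:R <= 3 * exp (L * (2 * k)%:R).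
  have b1 : 'C(n, b)%:R ^+ 2 <= exp (L * (2 * k)%:R).
    rewrite mulnC natrM mulrA mulr_natr expMn ler_pXn2r ?nnegrE ?(ltW (exp_gt0 _)) //.
    exact: bin_exp.
  have b2 : 'C(n, 2 * a)%:R <= exp (L * (2 * k)%:R).
    by apply: bin_exp; apply: leq_trans ak _; rewrite leq_pmull.
  have b3 : 'C(n, b)%:R <= exp (L * (2 * k)%:R).
    by apply: bin_exp; apply: leq_trans bk _; rewrite leq_pmull.
  move: (exp _) b1 b2 b3 => E; rewrite 2!natrD natrX; by lra.
have c2 : tail n l p eps <= exp (- (L * (2 * k + 2)%:R)).
  apply: ler_exp; rewrite lerN2 ler_pdivlMr; last first.
    by rewrite !mulr_gt0 ?exprn_gt0 //; move: n3; lra.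
  have : (64 * 64 * 64 * l%:R ^+ 2 * (2 * k + 2)%:R) * L <= (eps * p ^+ 2) ^+ 2 * n%:R.
    by apply: le_trans growth2; rewrite ler_wpM2r //; move: L1; lra.
  rewrite -/nu -/N => h.
  have l2 : 0 < l%:R ^+ 2 :> R by rewrite exprn_gt0 //; move: l1; lra.
  rewrite -(ler_pM2l l2).
  have -> : l%:R ^+ 2 * (eps / 32 * p ^+ 2 * N) ^+ 2 =
     (eps * p ^+ 2) ^+ 2 * n%:R / (32 * 32) * n%:R by rewrite nE; field.
  rewrite mulrA [leLHS]mulrA ler_pM2r; last by move: n3; lra.
  by move: h; lra.
have t0 : 0 <= tail n l p eps by rewrite ltW // exp_gt0.
apply: le_trans (ler_pM (ler0n _ _) t0 c1 c2) _.
rewrite -mulrA -expD (_ : L * (2 * k)%:R + - _ = - (L * 2)); last by rewrite natrD; ring.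
rewrite expV mulr_natr expMn Ln /gamma ler_pdivrMr; last by rewrite exprn_gt0 //; move: n3; lra.
have : eps * s <= w * n%:R.
  apply: ler_pM; [exact: ltW | exact: ltW | by move: eps_w w0; lra |].
  by rewrite -sn expr2 ler_pMl.
have : w * n%:R <= w * n%:R ^+ 2.
  by rewrite ler_pM2l // expr2 ler_peMl //; move: n3; lra.
by move: growth1 M1; lra.
Qed.

Variables (K r D : nat).
Hypothesis K0' : (0 < K)%N.
Hypothesis K_bounds : 200 * k%:R * L <= K%:R * w ^+ 2 <= 201 * k%:R * L.
Hypothesis r_bounds : r%:R <= (1 - w / 5) * K%:R * C / N ^+ 2 < r%:R + 1.

Let K0 : 0 < K%:R :> R. Proof. by rewrite ltr0n. Qed.

Let d := p * N / K%:R.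

(** Stronger than the requirement [10 <= beta * d]: it also makes the rounding of [D] cost at most
    [w / 50 * d]. *)
Let d_large : 100 <= w * d.
Proof.
have /andP[_ h] := K_bounds.
rewrite /d mulrA ler_pdivlMr //.
have w20 : 0 < w ^+ 2 by rewrite exprn_gt0.
have l0 : 0 < l%:R :> R by move: l1; lra.
rewrite -(ler_pM2r w20) -(ler_pM2r l0).
have -> : w * (p * N) * w ^+ 2 * l%:R = eps * p * n%:R by rewrite nE /eps; ring.
have h1 : eps ^+ 3 * p * n%:R <= eps * p * n%:R.
  rewrite ler_wpM2r // ler_wpM2r ?(ltW p0) //.
  by have /andP[_ e1] := ep 2; rewrite exprS ger_pMr.
have h2 : 100 * (201 * k%:R) * l%:R * L <= M * L ^+ 3.
  by apply: ler_pM => //; rewrite ?mulr_ge0 //; [move: L1; lra | case: Lpow].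
have : 100 * (K%:R * w ^+ 2) * l%:R <= 100 * (201 * k%:R * L) * l%:R.
  by rewrite ler_pM2r // ler_pM2l.
by move: growth4; lra.
Qed.

Let d0 : 0 < d.
Proof. by rewrite divr_gt0 // mulr_gt0 //; move: N3; lra. Qed.

Let d_codeg : N <= (5 / 4 * eps) ^+ 2 * (11 / 8 * w) * d ^+ 2.
Proof.
have /andP[h0 h] := K_bounds.
have w20 : 0 < w ^+ 2 by rewrite exprn_gt0.
have l0 : 0 < l%:R :> R by move: l1; lra.
have N0 : 0 < N by move: N3; lra.
have h1 : (K%:R * w ^+ 2) ^+ 2 * l%:R <= eps ^+ 2 * w ^+ 5 * p ^+ 2 * n%:R.
  apply: (@le_trans _ _ (eps ^+ 4 * p ^+ 2 * n%:R)); last first.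
    rewrite ler_wpM2r // ler_wpM2r ?sqr_ge0 // (_ : eps ^+ 4 = eps ^+ 2 * w ^+ 5 * w);
      last by rewrite /eps; ring.
    by rewrite ger_pMr ?mulr_gt0 ?exprn_gt0 //; move: w1; lra.
  apply: le_trans growth3; apply: (@le_trans _ _ ((201 * k%:R) ^+ 2 * l%:R * L ^+ 2)).
    have kw0 : 0 <= K%:R * w ^+ 2 by rewrite mulr_ge0 // ltW.
    by rewrite [leRHS]mulrAC ler_pM2r // -exprMn ler_pXn2r ?nnegrE ?(le_trans kw0 h).
  have [_ L2] := Lpow; have c0 : 0 <= (201 * k%:R) ^+ 2 * l%:R :> R.
    by apply: mulr_ge0; rewrite ?sqr_ge0.
  by apply: ler_pM; rewrite ?sqr_ge0.
rewrite /d expr_div_n [leRHS]mulrA ler_pdivlMr ?exprn_gt0 //.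
rewrite -(ler_pM2r (exprn_gt0 2 w20)) -(ler_pM2r l0).
have : N * ((K%:R * w ^+ 2) ^+ 2 * l%:R) <= N * (eps ^+ 2 * w ^+ 5 * p ^+ 2 * n%:R).
  by rewrite ler_pM2l.
have : 0 <= N * (eps ^+ 2 * w ^+ 5 * p ^+ 2 * n%:R).
  by rewrite !mulr_ge0 ?sqr_ge0 ?exprn_ge0 // ltW.
rewrite (_ : (5 / 4 * eps) ^+ 2 * (11 / 8 * w) * (p * N) ^+ 2 * w ^+ 2 ^+ 2 * l%:R =
  275 / 128 * (N * (eps ^+ 2 * w ^+ 5 * p ^+ 2 * n%:R))); last by rewrite nE; field.
by lra.
Qed.

Let q := N ^+ 2 / ((1 - gamma) * C).

Let gamma1 : gamma <= 1 / 128. Proof. by rewrite /gamma; move: w1; lra. Qed.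

(** With [mu = w / 8], the target is [exp ((mu - mu ^ 2) * K)]. The deficit [w / 5] in [r], still
    [18 / 100 * w] after the loss [gamma], beats [mu ^ 2] by a margin
    [(9 / 400 - 1 / 64) * K * w ^ 2]; since [K * w ^ 2 >= 200 * k * L], this pays for the at most
    [n ^ k] edges. *)
Let cover_small : #|H|%:R * (1 + w / 8 * q) ^+ r < (1 + w / 8) ^+ K.+1.
Proof.
have N20 : 0 < N ^+ 2 by rewrite exprn_gt0 //; move: N3; lra.
have g0 : 0 < 1 - gamma by move: gamma1; lra.
have q0 : 0 <= q by rewrite divr_ge0 ?sqr_ge0 // mulr_ge0 // ltW.
have h1 : #|H|%:R <= exp (L * k%:R).
  apply: le_trans (bin_exp (leqnn k)); rewrite hm -/C.
  by rewrite ger_pMl.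
have h2 : (1 + w / 8 * q) ^+ r <= exp (w / 8 * q * r%:R).
  by apply: expXn_le; rewrite addr_ge0 // mulr_ge0 //; move: w0; lra.
have h3 : exp ((w / 8 - (w / 8) ^+ 2) * K%:R) <= (1 + w / 8) ^+ K.
  rewrite mulr_natr expMn ler_pXn2r ?nnegrE ?(ltW (exp_gt0 _)) //; last by move: w0; lra.
  by apply: exp_le_1D; move: w0 w1; lra.
have h4 : (1 + w / 8) ^+ K < (1 + w / 8) ^+ K.+1.
  by rewrite ltr_eXn2l //; move: w0; lra.
apply: le_lt_trans h4; apply: le_trans h3.
have z : 0 <= (1 + w / 8 * q) ^+ r.
  by rewrite exprn_ge0 // addr_ge0 // mulr_ge0 //; move: w0; lra.
apply: le_trans (ler_pM (ler0n _ _) z h1 h2) _.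
rewrite -expD; apply: ler_exp.
have qr : q * r%:R <= (1 - w * (18 / 100)) * K%:R.
  have /andP[hr _] := r_bounds.
  apply: (@le_trans _ _ ((1 - w / 5) * K%:R / (1 - gamma))).
    rewrite (_ : (1 - w / 5) * K%:R / (1 - gamma) = q * ((1 - w / 5) * K%:R * C / N ^+ 2)).
      by rewrite ler_wpM2l.
    by rewrite /q; field; rewrite !gt_eqF //; move: N3; lra.
  rewrite ler_pdivrMr // mulrAC ler_pM2r //.
  by have := sqr_ge0 w; move: w0; rewrite /gamma; lra.
have : w / 8 * (q * r%:R) <= w / 8 * ((1 - w * (18 / 100)) * K%:R).
  by rewrite ler_wpM2l //; move: w0; lra.
have /andP[h0 _] := K_bounds; have kL : 0 <= k%:R * L by rewrite mulr_ge0 //; move: L1; lra.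
move: h0; lra.
Qed.


(** This is [n ^ - (k + 2)]. The bad events number at most [2 * K * 'C(n, k)], less than
    [n ^ (k + 1)] because [2 * K < n]. *)
Let delta := exp (- (L * (k + 2)%:R)).

Let eps16 : (eps / 16) ^+ 2 / 8 = eps ^+ 2 / (64 * 32).
Proof. by rewrite expr_div_n; field. Qed.

Let delta_low : exp (- (low n l p eps / K%:R * (eps / 16) ^+ 2 / 8)) <= delta.
Proof.
have /andP[_ h] := K_bounds; have w20 : 0 < w ^+ 2 by rewrite exprn_gt0.
have l0 : 0 < l%:R :> R by move: l1; lra.
have N0 : 0 < N by move: N3; lra.
apply: ler_exp; rewrite lerN2 -mulrA eps16.
have h1 : d * (1 / 2) * (eps ^+ 2 / (64 * 32)) <= low n l p eps / K%:R * (eps ^+ 2 / (64 * 32)).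
  have e0 : 0 <= eps ^+ 2 / (64 * 32) by have := sqr_ge0 eps; lra.
  rewrite ler_wpM2r //.
  rewrite /low /d -/nu -/N mulrAC ler_pM2r ?invr_gt0 //.
  have : 0 < p * N by rewrite mulr_gt0.
  have : eps * (p * N) <= 1 / 8 * (p * N) by rewrite ler_pM2r ?eps8 // mulr_gt0.
  by lra.
apply: le_trans h1; rewrite (_ : d * _ * _ = d * eps ^+ 2 / (64 * 64)); last by field.
have q0 : 0 < 64 * 64 :> R by lra.
rewrite (ler_pdivlMr _ _ q0) /d [leRHS]mulrAC ler_pdivlMr // -(ler_pM2r w20) -(ler_pM2r l0).
have h2 : (K%:R * w ^+ 2) * (L * (64 * 64) * (k + 2)%:R * l%:R) <=
   (201 * k%:R * L) * (L * (64 * 64) * (k + 2)%:R * l%:R).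
  by rewrite ler_wpM2r // !mulr_ge0 //; move: L1; lra.
have h3 : (64 * 64) * (201 * k%:R) * (k + 2)%:R * l%:R * L ^+ 2 <= M * L ^+ 3.
  by apply: ler_pM; rewrite ?sqr_ge0 ?mulr_ge0 //; case: Lpow.
have h4 : eps ^+ 3 * p * n%:R <= eps ^+ 2 * w ^+ 2 * (p * n%:R).
  rewrite [leLHS](_ : _ = eps ^+ 2 * eps * (p * n%:R)); last by ring.
  rewrite ler_wpM2r ?mulr_ge0 ?(ltW p0) // ler_wpM2l ?sqr_ge0 //.
  by move: eps_w2 (sqr_ge0 w); lra.
rewrite (_ : p * N * eps ^+ 2 * w ^+ 2 * l%:R = eps ^+ 2 * w ^+ 2 * (p * n%:R));
  last by rewrite nE; ring.
apply: le_trans h4; apply: le_trans growth4; apply: le_trans h3.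
by move: h2; lra.
Qed.

Let delta_high : exp (- (high n l p eps / K%:R ^+ 2 * (eps / 16) ^+ 2 / 8)) <= delta.
Proof.
have /andP[_ h] := K_bounds; have w20 : 0 < w ^+ 2 by rewrite exprn_gt0.
have l0 : 0 < l%:R :> R by move: l1; lra.
have N0 : 0 < N by move: N3; lra.
apply: ler_exp; rewrite lerN2 -mulrA eps16.
have h1 : p ^+ 2 * N / K%:R ^+ 2 * (eps ^+ 2 / (64 * 32))
  <= high n l p eps / K%:R ^+ 2 * (eps ^+ 2 / (64 * 32)).
  have e0 : 0 <= eps ^+ 2 / (64 * 32) by have := sqr_ge0 eps; lra.
  rewrite ler_wpM2r //.
  rewrite ler_pM2r ?invr_gt0 ?exprn_gt0 // /high -/nu -/N ler_pM2r //.
  rewrite ler_peMl ?sqr_ge0 //; move: eps0; lra.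
apply: le_trans h1.
rewrite (_ : p ^+ 2 * N / K%:R ^+ 2 * (eps ^+ 2 / (64 * 32)) =
    p ^+ 2 * N * eps ^+ 2 / (64 * 32) / K%:R ^+ 2); last by field; rewrite gt_eqF.
have q0 : 0 < 64 * 32 :> R by lra.
rewrite ler_pdivlMr ?exprn_gt0 // (ler_pdivlMr _ _ q0) -(ler_pM2r (exprn_gt0 2 w20)) -(ler_pM2r l0).
have h2 : (K%:R * w ^+ 2) ^+ 2 * (L * (64 * 32) * (k + 2)%:R * l%:R) <=
   (201 * k%:R * L) ^+ 2 * (L * (64 * 32) * (k + 2)%:R * l%:R).
  rewrite ler_wpM2r //; first by rewrite !mulr_ge0 //; move: L1; lra.
  have kw0 : 0 <= K%:R * w ^+ 2 by rewrite mulr_ge0 // ltW.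
  by rewrite ler_pXn2r ?nnegrE ?(le_trans kw0 h).
have h3 : (64 * 32) * (201 * k%:R) ^+ 2 * (k + 2)%:R * l%:R * L ^+ 3 <= M * L ^+ 3.
  by rewrite ler_wpM2r ?exprn_ge0 //; move: L1; lra.
have h4 : eps ^+ 4 * p ^+ 2 * n%:R <= eps ^+ 2 * (w ^+ 2) ^+ 2 * (p ^+ 2 * n%:R).
  rewrite [leLHS](_ : _ = eps ^+ 2 * eps ^+ 2 * (p ^+ 2 * n%:R)); last by ring.
  have pn0 : 0 <= p ^+ 2 * n%:R by apply: mulr_ge0; rewrite ?sqr_ge0.
  rewrite (ler_wpM2r pn0) // ler_wpM2l ?sqr_ge0 //.
  rewrite ler_pXn2r ?nnegrE ?(ltW eps0) ?(ltW w20) //.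
  by move: eps_w2 (sqr_ge0 w); lra.
rewrite (_ : p ^+ 2 * N * eps ^+ 2 * w ^+ 2 ^+ 2 * l%:R = eps ^+ 2 * (w ^+ 2) ^+ 2 * (p ^+ 2 * n%:R));
  last by rewrite nE; ring.
apply: le_trans h4; apply: le_trans growth3; apply: le_trans h3.
by move: h2; lra.
Qed.

(** The [nu ^ 2] block unions for the identity permutation are distinct [k]-sets. The bound makes
    [r] large enough for its rounding to be harmless. *)
Let NC : N ^+ 2 <= C.
Proof.
rewrite -natrX ler_nat -[n in 'C(n, _)]card_ord -card_draws.
have <- : #|cov l a (1%g : {perm 'I_n})| = (nu ^ 2)%N.
  rewrite card_imset ?card_prod ?card_ord ?mulnn // => -[j i] [j' i'] /=.
  by move=> /(edge_inj ln nu3 a0 al)[/= -> ->].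
apply: subset_leq_card; apply/subsetP => x /imsetP[[j i] _ ->].
rewrite inE /edge card_imset; last exact: perm_inj.
by apply/eqP; exact: (card_linkfree ln nu3 al).
Qed.

Let hdelta : (r * (nu + nu + nu ^ 2))%:R * delta < 1.
Proof.
have /andP[hr _] := r_bounds.
have N0 : 0 < N by move: N3; lra.
have N20 : 0 < N ^+ 2 by rewrite exprn_gt0.
have n0 : 0 < n%:R :> R by move: n3; lra.
have h1 : r%:R * N ^+ 2 <= K%:R * C.
  rewrite -ler_pdivlMr //; apply: le_trans hr _.
  rewrite ler_pM2r ?invr_gt0 // ler_pM2r // ger_pMl //; move: w0; lra.
have h2 : (r * (nu + nu + nu ^ 2))%:R <= 2 * (r%:R * N ^+ 2).
  rewrite natrM !natrD natrX -/N mulrCA ler_wpM2l //.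
  have : 3 * N <= N * N by rewrite ler_pM2r.
  by rewrite expr2; lra.
have h3 : K%:R * 2 < n%:R :> R.
  have := d_large; rewrite /d mulrA ler_pdivlMr // => h.
  have : w * (p * N) <= 1 * n%:R.
    apply: ler_pM; [exact: ltW | by rewrite mulr_ge0 // ltW | by move: w1; lra |].
    have : p * N <= 1 * N by rewrite ler_pM2r.
    have : N * 1 <= N * l%:R by rewrite ler_pM2l.
    by rewrite nE; lra.
  by move: K0; lra.
have h4 : C <= exp (L * k%:R) by apply: bin_exp.
have h5 : exp (L * k%:R) * n%:R * n%:R * delta = 1.
  rewrite -Ln -!expD -[RHS]exp0; congr exp; rewrite natrD; ring.
have d0' : 0 < delta := exp_gt0 _.
rewrite -[ltRHS]h5 ltr_pM2r //; apply: le_lt_trans h2 _.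
apply: (@le_lt_trans _ _ (K%:R * 2 * exp (L * k%:R))).
  have : K%:R * C <= K%:R * exp (L * k%:R) by rewrite ler_pM2l.
  by lra.
rewrite mulrC -mulrA ltr_pM2l ?exp_gt0 //; apply: lt_le_trans h3 _.
by rewrite ler_peMl //; move: n3; lra.
Qed.

Let c := 1 - 5 / 4 * eps - 11 / 8 * w.

Hypothesis degA : forall S : {set 'I_n}, #|S| = (2 * a)%N ->
  (1 - eps) * 'C(n - 2 * a, b)%:R * p <= (deg k H S)%:R.
Hypothesis degB : forall S : {set 'I_n}, #|S| = b ->
  (1 - eps) * 'C(n - b, 2 * a)%:R * p <= (deg k H S)%:R.
Hypothesis codegB : forall S1 S2 : {set 'I_n}, #|S1| = b -> #|S2| = b -> [disjoint S1 & S2] ->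
  #|nbhd k H S1 :&: nbhd k H S2|%:R <= (1 + eps) * 'C(n - 2 * b, 2 * a)%:R * p ^+ 2.
Hypothesis D_bounds : D%:R <= c * d < D%:R + 1.

Lemma packing_asymptotic : exists Cs : seq {set {set 'I_n}},
  [/\ forall C, C \in Cs -> ham_cycle k l H C,
      pairwise (fun C1 C2 : {set {set 'I_n}} => [disjoint C1 & C2]) Cs &
      (1 - 2 * w) * #|H|%:R / N <= (size Cs)%:R].
Proof.
have /andP[D1 D2] := D_bounds.
have /andP[r1 r2] := r_bounds.
have /andP[k1 k2] := K_bounds.
have N0 : 0 < N by move: N3; lra.
have g0 : 0 < 1 - gamma by move: gamma1; lra.
have w20 : 0 < w ^+ 2 by rewrite exprn_gt0.
have q0 : 0 <= q by rewrite divr_ge0 ?sqr_ge0 // mulr_ge0 // ltW.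
have hb1 : (1 - eps / 32) * 'C(n, b)%:R <= 'C(n - 2 * a, b)%:R.
  by apply: bin_small => //; apply: leq_trans kn; rewrite /k; move: al; clear; lia.
have hb2 : (1 - eps / 32) * 'C(n, 2 * a)%:R <= 'C(n - b, 2 * a)%:R.
  apply: bin_small; first by rewrite mulnC.
  by apply: leq_trans kn; rewrite /k /b; clear; lia.
have mu0 : 0 < w / 8 by rewrite divr_gt0.
have gl1 : gamma < 1 by move: gamma1; lra.
have hq : N ^+ 2 <= q * (1 - gamma) * C.
  by rewrite /q -mulrA divfK // mulf_neq0 // gt_eqF.
have be0 : 0 < 11 / 8 * w by rewrite mulr_gt0 //; lra.
have be1 : 11 / 8 * w <= 1 - 5 / 4 * eps by move: eps_w w1; lra.
(* Here [w <= 1 / 2] gives [eps <= w ^ 2 / 2], so the left side is at most [15 / 8 * w ^ 2], just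
   below [(11 / 8) ^ 2 * w ^ 2]. *)
have be2 : 3 * (5 / 4 * eps) <= (11 / 8 * w) ^+ 2 by rewrite exprMn; move: eps_w2 w20; lra.
have hd : 10 <= 11 / 8 * w * d by move: d_large; lra.
have hD : D%:R <= (1 - 5 / 4 * eps - 11 / 8 * w) * d by [].
have [Cs [hC dC sC]] := packing ln nu3 a0 al kn unifH p0 p1 eps0 eps8
   degA degB codegB hb1 hb2 tail_small K0' mu0 q0 gl1 hq cover_small
   be0 be1 be2 d_codeg hd hD delta_low delta_high hdelta.
exists Cs; split=> //; rewrite sC natrM hm -/C.
pose rho := (1 - w / 5) * K%:R * C / N ^+ 2.
(* Rounding [rho] down to [r] therefore costs at most a factor [1 - w / 50]. *)
have rho1 : 1 <= rho * (w / 50).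
  have kL : 3 * 1 <= k%:R * L by apply: ler_pM => //; move: k3; lra.
  have Kw : 60 <= K%:R * w.
    have : K%:R * w ^+ 2 <= K%:R * w * (1 / 2).
      by rewrite expr2 mulrA ler_pM2l // mulr_gt0.
    by lra.
  have CN : 1 <= C / N ^+ 2 by rewrite ler_pdivlMr ?mul1r // exprn_gt0.
  have : 60 * 1 <= K%:R * w * (C / N ^+ 2) by apply: ler_pM.
  have : 9 / 10 * (K%:R * w * (C / N ^+ 2)) <= (1 - w / 5) * (K%:R * w * (C / N ^+ 2)).
    rewrite ler_wpM2r //; last by move: w1; lra.
    by apply: mulr_ge0; rewrite ?divr_ge0 ?sqr_ge0 ?mulr_ge0 // ltW.
  rewrite (_ : rho * (w / 50) = (1 - w / 5) * (K%:R * w * (C / N ^+ 2)) / 50);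
    last by rewrite /rho; field; rewrite gt_eqF.
  by lra.
have rr : rho * (1 - w / 50) <= r%:R by move: r2; rewrite -/rho; lra.
have DD : (c - w / 50) * d <= D%:R by move: d_large D2; lra.
have rho0 : 0 < rho.
  rewrite ltNge; apply/negP => h;
    have : rho * (w / 50) <= 0 by rewrite mulr_le0_ge0 // divr_ge0 // ltW.
  by lra.
(* As [eps <= w / 4], the losses are at most [5 / 16], [11 / 8] and [1 / 50] times [w], together
   less than [171 / 100 * w]. *)
have c0 : 1 - 171 / 100 * w <= c - w / 50 by rewrite /c; move: eps_w w0; lra.
have cw : 0 <= 1 - 171 / 100 * w by move: w1; lra.
have w50 : 0 <= 1 - w / 50 by move: w1; lra.
have main : rho * (1 - w / 50) * ((1 - 171 / 100 * w) * d) <= r%:R * D%:R.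
  apply: ler_pM => //.
  - by rewrite mulr_ge0 // ltW.
  - by rewrite mulr_ge0 // ltW.
  - by apply: le_trans DD; rewrite ler_pM2r.
apply: le_trans main.
have -> : rho * (1 - w / 50) * ((1 - 171 / 100 * w) * d) =
  (1 - w / 50) * ((1 - w / 5) * (1 - 171 / 100 * w)) * (p * C / N).
  by rewrite /rho /d; field; rewrite !gt_eqF.
rewrite -[leLHS]mulrA ler_wpM2r //.
  by rewrite !mulr_ge0 ?invr_ge0 // ltW.
exact: loss_bound (ltW w0) w1.
Qed.

End Asymptotics.

(** * Choice of the integer parameters and return to the stated inequalities *)

Section Conclusion.
Local Open Scope ring_scope.

(** The sum of the seven lower bounds required of [M]; its terms being nonnegative, it dominates
    each of them. *)
Definition growth_const (l a : nat) : R :=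
  64 * 3 + 32 * (2 * a * (l - a))%:R + 64 * 64 * 64 * l%:R ^+ 2 * (2 * (l + a) + 2)%:R
  + (201 * (l + a)%:R) ^+ 2 * l%:R + 100 * (201 * (l + a)%:R) * l%:R
  + 64 * 64 * (201 * (l + a)%:R) * (l + a + 2)%:R * l%:R
  + 64 * 32 * (201 * (l + a)%:R) ^+ 2 * (l + a + 2)%:R * l%:R.

Lemma growth_const_gt0 l a : 0 < growth_const l a.
Proof.
by rewrite /growth_const -!addrA ltr_pwDl ?mulr_gt0 // !addr_ge0 // !mulr_ge0 ?sqr_ge0.
Qed.

Lemma exists_packing (n l a : nat) (H : {set {set 'I_n}}) (p w L s : R) :
  (l %| n)%N -> (2 < n %/ l)%N -> (0 < a)%N -> (a < l)%N -> (l + a <= n)%N ->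
  k_uniform (l + a) H -> 0 < p -> p <= 1 -> 0 < w -> w <= 1 / 2 ->
  0 < s -> s ^+ 2 = n%:R -> 1 <= L -> exp L = n%:R ->
  #|H|%:R = p * 'C(n, l + a)%:R ->
  growth_const l a * L ^+ 3 < (w ^+ 3) ^+ 5 * s * p ^+ 2 ->
  (forall S : {set 'I_n}, #|S| = (2 * a)%N ->
    (1 - w ^+ 3) * 'C(n - 2 * a, l - a)%:R * p <= (deg (l + a) H S)%:R) ->
  (forall S : {set 'I_n}, #|S| = (l - a)%N ->
    (1 - w ^+ 3) * 'C(n - (l - a), 2 * a)%:R * p <= (deg (l + a) H S)%:R) ->
  (forall S1 S2 : {set 'I_n}, #|S1| = (l - a)%N -> #|S2| = (l - a)%N ->
    [disjoint S1 & S2] ->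
    #|nbhd (l + a) H S1 :&: nbhd (l + a) H S2|%:R <=
      (1 + w ^+ 3) * 'C(n - 2 * (l - a), 2 * a)%:R * p ^+ 2) ->
  exists Cs : seq {set {set 'I_n}},
    [/\ forall C, C \in Cs -> ham_cycle (l + a) l H C,
        pairwise (fun C1 C2 : {set {set 'I_n}} => [disjoint C1 & C2]) Cs &
        (1 - 2 * w) * #|H|%:R / (n %/ l)%:R <= (size Cs)%:R].
Proof.
move=> ln nu3 a0 al kn unifH p0 p1 w0 w1 s0 sn L1 Ln hm growth degA degB codegB.
have w20 : 0 < w ^+ 2 by rewrite exprn_gt0.
have w2 : w ^+ 2 <= 1 / 4.
  by have : w * w <= 1 / 2 * (1 / 2); [apply: ler_pM; rewrite ?(ltW w0) | rewrite expr2; lra].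
have kL : 3 * 1 <= (l + a)%:R * L.
  by apply: ler_pM => //; rewrite (ler_nat _ 3); move: a0 al; clear; lia.
have X0 : 0 <= 200 * (l + a)%:R * L / w ^+ 2.
  by rewrite divr_ge0 ?(ltW w20) //; lra.
have [m /andP[m1 m2]] := exists_floor X0.
(* [K] is [m.+1], rounded up to keep the lower bound; the surplus [w ^ 2] is covered by one more
   [(l + a) * L], hence 201. *)
have hK : 200 * (l + a)%:R * L <= m.+1%:R * w ^+ 2 <= 201 * (l + a)%:R * L.
  apply/andP; split; first by rewrite -ler_pdivrMr // -[m.+1%:R]natr1 ltW.
  have : m.+1%:R * w ^+ 2 <= (200 * (l + a)%:R * L / w ^+ 2 + 1) * w ^+ 2.
    by rewrite ler_pM2r // -[m.+1%:R]natr1 lerD2r.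
  by rewrite mulrDl divfK ?gt_eqF // mul1r; lra.
have Y0 : 0 <= (1 - w / 5) * m.+1%:R * 'C(n, l + a)%:R / (n %/ l)%:R ^+ 2.
  by rewrite divr_ge0 ?sqr_ge0 // !mulr_ge0 //; lra.
have [r hr] := exists_floor Y0.
have w3 : w ^+ 3 <= 1 / 4 * w by rewrite exprSr ler_pM2r.
have Z0 : 0 <= (1 - 5 / 4 * w ^+ 3 - 11 / 8 * w) * (p * (n %/ l)%:R / m.+1%:R).
  by apply: mulr_ge0; [lra | rewrite divr_ge0 // mulr_ge0 // ltW].
have [D hD] := exists_floor Z0.
pose x : R := (l + a)%:R; pose y : R := l%:R; pose z : R := (l + a + 2)%:R.
have t2 : 0 <= (2 * a * (l - a))%:R :> R by [].
have t3 : 0 <= y ^+ 2 * (2 * (l + a) + 2)%:R by rewrite mulr_ge0 ?sqr_ge0.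
have t4 : 0 <= x ^+ 2 * y by rewrite mulr_ge0 ?sqr_ge0.
have t5 : 0 <= x * y by rewrite mulr_ge0.
have t6 : 0 <= x * y * z by rewrite mulr_ge0.
have t7 : 0 <= x ^+ 2 * y * z by rewrite mulr_ge0.
apply: (packing_asymptotic ln nu3 a0 al kn unifH p0 p1 w0 w1 s0 sn L1 Ln hm
  _ _ _ _ _ _ _ growth (ltn0Sn m) hK hr degA degB codegB hD);
  rewrite /growth_const -/x -/y -/z;
  move: (2 * a * (l - a))%:R (2 * (l + a) + 2)%:R x y z t2 t3 t4 t5 t6 t7;
  clear; move=> u v x y z t2 t3 t4 t5 t6 t7; lra.
Qed.

Lemma Rfloor_le (x : R) : (Rfloor x <= x)%Re.
Proof. by case: (base_Int_part x). Qed.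

Lemma Rceil_ge (x : R) : (x <= Rceil x)%Re.
Proof. by have := Rfloor_le (- x)%Re; rewrite /Rceil; Lra.lra. Qed.

Lemma ln_ge1 (x : R) : (3 <= x)%Re -> (1 <= Rpower.ln x)%Re.
Proof.
move=> x3; case: (Rle_lt_or_eq_dec _ _ (Rle_trans _ _ _ exp_le_3 x3)) => [lt|<-].
  rewrite -{1}(ln_exp 1%Re); apply/Rlt_le/ln_increasing => //; exact: exp_pos.
by rewrite ln_exp; exact: Rle_refl.
Qed.

Lemma trivial_bound (w m x : R) :
  (1 / 2 <= w)%Re -> (0 <= m)%Re -> (0 < x)%Re -> ((1 - 2 * w) * m / x <= 0)%Re.
Proof.
move=> w2 m0 x0; have h := Rle_mult_inv_pos _ _ m0 x0.
have : (0 <= (2 * w - 1) * (m * / x))%Re by apply: Rmult_le_pos => //; Lra.lra.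
by rewrite /Rdiv; Lra.lra.
Qed.

End Conclusion.

Theorem theorem3 (k l : nat) (p eps : nat -> R) :
  k < 2 * l -> l < k ->
  (forall n, l %| n -> (0 < p n <= 1)%Re /\ (eps n < 1)%Re) ->
  growth_cond l p eps ->
  exists N : nat, forall n : nat, N <= n -> l %| n ->
    forall H : {set {set 'I_n}},
      k_uniform k H ->
      p n = (INR #|H| / INR 'C(n, k))%Re ->
      Pa k l H (p n) (eps n) -> Pb k l H (p n) (eps n) ->
      Pc k l H (p n) (eps n) -> Pd k l H (p n) (eps n) ->
      Pe k l H (p n) (eps n) -> Pf k l H (p n) (eps n) ->
      exists Cs : seq {set {set 'I_n}},
        (forall C, C \in Cs -> ham_cycle k l H C) /\
        pairwise (fun C1 C2 : {set {set 'I_n}} => [disjoint C1 & C2]) Cs /\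
        ((1 - 2 * Rpower (eps n) (1 / 3)) * INR #|H| / (INR n / INR l)
           <= INR (size Cs))%Re.
Proof.
move=> k2 lk hp growth; pose a := k - l.
have kE : k = l + a by rewrite subnKC // ltnW.
have a0 : 0 < a by rewrite subn_gt0.
have al : a < l by rewrite /a; move: k2 lk; clear; lia.
have l0 : 0 < l by exact: leq_ltn_trans al.
have [N0 hN0] := growth (growth_const l a).
(* The bound [3 * l + 3] gives at least three blocks, [k <= n] since [k < 2 * l], and [3 <= n], so
   that [ln n] is at least 1. *)
exists (maxn N0 (3 * l + 3)) => n;
  rewrite geq_max => /andP[/hN0 gr nl] ln H unifH pE hPa hPb _ _ hPe _.
have {gr} := gr ln; have [[p0 p1] e1] := hp n ln.
move: (p n) (eps n) p0 p1 e1 pE hPa hPb hPe => {p eps hp growth hN0} {}p {}eps p0 p1 e1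
  pE hPa hPb hPe gr.
have n3 : (3 <= INR n)%Re.
  have : (INR 3 <= INR n)%Re by apply: le_INR; apply/ssrnat.leP; move: nl; clear; lia.
  by rewrite /=; Lra.lra.
have L1 := ln_ge1 n3; set L := Rpower.ln (INR n) in L1 gr.
have L30 : (0 < L ^ 3)%Re by apply: pow_lt; Lra.lra.
have s0 : (0 < sqrt (INR n))%Re by apply: sqrt_lt_R0; Lra.lra.
have {}gr : (growth_const l a * L ^ 3 < eps ^ 5 * sqrt (INR n) * p ^ 2)%Re.
  have := Rmult_lt_compat_r _ _ _ L30 gr.
  by rewrite /Rdiv Rmult_assoc Rinv_l ?Rmult_1_r //; Lra.lra.
have M0 : (0 < growth_const l a)%Re by apply/RltP; exact: growth_const_gt0.
(* Positivity, without which [Rpower] is no cube root, comes from the growth condition: the fifth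
   power has the sign of [eps]. *)
have eps0 : (0 < eps)%Re.
  case: (Rlt_le_dec 0%Re eps) => // e0.
  have h1 := Rmult_lt_0_compat _ _ M0 L30.
  have h2 : (0 <= (eps ^ 2) ^ 2 * sqrt (INR n) * p ^ 2)%Re.
    by apply: Rmult_le_pos; [apply: Rmult_le_pos; [exact: pow2_ge_0 | Lra.lra] | exact: pow2_ge_0].
  move: gr h1; rewrite (_ : eps ^ 5 * sqrt (INR n) * p ^ 2 =
     eps * ((eps ^ 2) ^ 2 * sqrt (INR n) * p ^ 2))%Re; last by rewrite /=; Lra.lra.
  have : (0 <= - eps * ((eps ^ 2) ^ 2 * sqrt (INR n) * p ^ 2))%Re.
    by apply: Rmult_le_pos => //; Lra.lra.
  by Lra.lra.
set w := Rpower eps (1 / 3)%Re.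
have w0 : (0 < w)%Re by exact: exp_pos.
have w3 : (w ^ 3 = eps)%Re.
  rewrite -Rpower_pow // /w Rpower_mult (_ : (1 / 3 * INR 3 = 1)%Re) ?Rpower_1 //.
  by rewrite /=; Lra.lra.
have nl0 : (0 < INR n / INR l)%Re.
  by apply: Rdiv_lt_0_compat; [Lra.lra | apply: lt_0_INR; apply/ssrnat.ltP].
(* For [w >= 1 / 2] the required number of cycles is not positive and the empty collection
   suffices. *)
case: (Rle_lt_dec (1 / 2)%Re w) => [w2|w2].
  by exists [::]; split=> //; split=> //; apply: trivial_bound => //; exact: pos_INR.
have nuE : (INR n / INR l)%Re = (n %/ l)%:R%R.
  by rewrite !INRE -{1}(divnK ln) natrM RdivE mulfK // pnatr_eq0 -lt0n.
have kn : l + a <= n by rewrite -kE; move: nl k2 lk a0; clear; lia.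
have nu3 : 2 < n %/ l by rewrite leq_divRL //; move: nl; clear; lia.
have bE : 2 * l - k = l - a by rewrite kE; clear; lia.
have bE' : n - 2 * l + k = n - (l - a) by move: kn nl al; rewrite kE; clear; lia.
have rw1 : (w <= 1 / 2)%R by apply/RleP; rewrite RdivE in w2; exact: Rlt_le.
have sn : (sqrt (INR n) ^+ 2 = n%:R :> R)%R.
  by rewrite -RpowE -INRE /= Rmult_1_r sqrt_sqrt //; Lra.lra.
have hm : (#|H|%:R = p * 'C(n, l + a)%:R :> R)%R.
  rewrite pE !INRE RdivE -kE mulfVK // pnatr_eq0 -lt0n bin_gt0 kE.
  exact: kn.
have Ln : exp L = n%:R%R by rewrite -INRE /L exp_ln //; Lra.lra.
have rgr : (growth_const l a * L ^+ 3 < (w ^+ 3) ^+ 5 * sqrt (INR n) * p ^+ 2)%R.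
  by apply/RltP; rewrite -!RpowE w3; exact: gr.
have degA (S : {set 'I_n}) : #|S| = 2 * a ->
    ((1 - w ^+ 3) * 'C(n - 2 * a, l - a)%:R * p <= (deg (l + a) H S)%:R)%R.
  move=> cS; apply/RleP; rewrite -!INRE -RpowE w3 -kE -bE.
  exact: Rle_trans (Rceil_ge _) (hPa S cS).
have degB (S : {set 'I_n}) : #|S| = l - a ->
    ((1 - w ^+ 3) * 'C(n - (l - a), 2 * a)%:R * p <= (deg (l + a) H S)%:R)%R.
  move=> cS; apply/RleP; rewrite -!INRE -RpowE w3 -kE -bE'.
  by apply: Rle_trans (Rceil_ge _) (hPb S _); rewrite bE.
have codegB (S1 S2 : {set 'I_n}) : #|S1| = l - a -> #|S2| = l - a -> [disjoint S1 & S2] ->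
    (#|nbhd (l + a) H S1 :&: nbhd (l + a) H S2|%:R <=
      (1 + w ^+ 3) * 'C(n - 2 * (l - a), 2 * a)%:R * p ^+ 2)%R.
  move=> c1 c2 dS; apply/RleP; rewrite -!INRE -!RpowE w3 -kE -bE.
  by apply: Rle_trans (hPe S1 S2 _ _ dS) (Rfloor_le _); rewrite bE.
have unifH' : k_uniform (l + a) H by rewrite -kE.
have [[rp0 rp1] [rw0 rs0]] : ((0 < p)%R /\ (p <= 1)%R) /\ ((0 < w)%R /\ (0 < sqrt (INR n))%R).
  by split; split; [apply/RltP | apply/RleP | apply/RltP | apply/RltP].
have rL1 : (1 <= L)%R by apply/RleP.
have [Cs [hC dC sC]] := exists_packing ln nu3 a0 al kn unifH' rp0 rp1 rw0 rw1 rs0 sn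
  rL1 Ln hm rgr degA degB codegB.
exists Cs; split; first by rewrite kE.
split=> //; rewrite nuE !INRE; apply/RleP; exact: sC.
Qed.
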